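(* Let $a,b>0$. The perimeter $L_{(1)}$ of the superellipse $\mathscr{C}_s(a,b)$ at the transition value $s=1$ (rhombus) equals $$L_{(1)}=4\sqrt{a^2+b^2}.$$ This value is recovered as the common Abel-regularized limit of the positive and negative branches, i.e. $$\lim_{s\to1^{+}}\lim_{\epsilon\to1^-}L^{+}_{(s)}(\epsilon)=\lim_{s\to1^{-}}\lim_{\epsilon\to1^-}L^{-}_{(s)}(\epsilon)=4\sqrt{a^2+b^2},$$ where, for $0<\epsilon<1$, $$L_{(s)}^{\pm}(\epsilon)=\frac{2\sqrt{a^2+b^2}}{\pm(s-1)}\sum_{k=0}^{\infty}\frac{(-\epsilon)^k(\alpha)_k}{k!\,u_k^{\pm}}\left[{}_2F_1\left(-\tfrac12,1;u_k^{\pm}+1;\tfrac{b^2}{a^2+b^2}\right)+{}_2F_1\left(-\tfrac12,1;u_k^{\pm}+1;\tfrac{a^2}{a^2+b^2}\right)\right],$$ with the upper sign for $s>1$ and the lower sign for $0<s<1$.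
   Context: For $a,b,s>0$, the superellipse (Lamé curve) $\mathscr{C}_s(a,b)$ is the closed plane curve given in polar coordinates by $r=r_{a,b}(\theta)=\left(\frac{|\cos\theta|^s}{a^s}+\frac{|\sin\theta|^s}{b^s}\right)^{-1/s}$, $0\le\theta<2\pi$; its perimeter is its total arc length. Here $\alpha=1+\frac1s$, $u_k^{+}=\frac{sk+1}{2(s-1)}$, $u_k^{-}=\frac{s(k+1)}{2(1-s)}$, $(q)_k=\Gamma(q+k)/\Gamma(q)$ is the Pochhammer symbol, and ${}_2F_1$ is the Gauss hypergeometric function. *)

(* Defs.v *)
From HB Require Import structures.
From mathcomp Require Import all_boot all_order all_algebra.
From mathcomp Require Import all_classical all_reals all_analysis.

Set Implicit Arguments.
Unset Strict Implicit.
Unset Printing Implicit Defensive.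

Import Order.TTheory GRing.Theory Num.Theory.
Import numFieldNormedType.Exports.

Local Open Scope classical_set_scope.
Local Open Scope ring_scope.

Definition inscribed_length (R : realType) (gamma : R -> R * R) (a b : R)
    (s : seq R) : R :=
  let P := gamma \o nth b (a :: s) in
  \sum_(0 <= n < size s)
    Num.sqrt (((P n.+1).1 - (P n).1) ^+ 2 + ((P n.+1).2 - (P n).2) ^+ 2).

(* Euclidean counterpart of [total_variation]: the supremum of the lengths of
   the polygonal lines inscribed in the arc. *)
Definition arc_length (R : realType) (gamma : R -> R * R) (a b : R) : \bar R :=
  ereal_sup [set (inscribed_length gamma a b s)%:E | s in itv_partition a b].

Definition superellipse_radius (R : realType) (s a b theta : R) : R :=
  (`|cos theta| `^ s / a `^ s + `|sin theta| `^ s / b `^ s) `^ (- s^-1).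

Definition superellipse (R : realType) (s a b theta : R) : R * R :=
  (superellipse_radius s a b theta * cos theta,
   superellipse_radius s a b theta * sin theta).

(* The parameter runs over the closed interval [0, 2 pi], so that the two
   endpoints coincide and the closed curve is travelled exactly once. *)
Definition superellipse_perimeter (R : realType) (s a b : R) : \bar R :=
  arc_length (superellipse s a b) 0 (2 * pi).

(* Euler's integral, meaningful for 0 < x. *)
Definition Gamma_Euler (R : realType) (x : R) : R :=
  Rintegral (@lebesgue_measure R) `]0, +oo[
    (fun t => t `^ (x - 1) * expR (- t)).

(* For x <= 0 the function is continued through Gamma (x + 1) = x * Gamma x,
   using that x + Num.bound x > 0; the value at a pole is the junk value 0. *)
Definition Gamma (R : realType) (x : R) : R :=
  if 0 < x then Gamma_Euler x
  else Gamma_Euler (x + (Num.bound x)%:R) /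
       \prod_(0 <= i < Num.bound x) (x + i%:R).

Definition pochhammer (R : realType) (q : R) (k : nat) : R :=
  Gamma (q + k%:R) / Gamma q.

Definition hypergeometric21 (R : realType) (a b c z : R) : R :=
  limn (series (fun n : nat =>
    pochhammer a n * pochhammer b n / pochhammer c n * (z ^+ n / n`!%:R))).

Definition alpha (R : realType) (s : R) : R := 1 + s^-1.

Definition u_plus (R : realType) (s : R) (k : nat) : R :=
  (s * k%:R + 1) / (2 * (s - 1)).

Definition u_minus (R : realType) (s : R) (k : nat) : R :=
  s * (k%:R + 1) / (2 * (1 - s)).

Definition perimeter_term (R : realType) (u : nat -> R) (a b s eps : R)
    (k : nat) : R :=
  (- eps) ^+ k * pochhammer (alpha s) k / (k`!%:R * u k) *
  (hypergeometric21 (- 2^-1) 1 (u k + 1) (b ^+ 2 / (a ^+ 2 + b ^+ 2)) +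
   hypergeometric21 (- 2^-1) 1 (u k + 1) (a ^+ 2 / (a ^+ 2 + b ^+ 2))).

Definition L_plus (R : realType) (a b s eps : R) : R :=
  2 * Num.sqrt (a ^+ 2 + b ^+ 2) / (s - 1) *
  limn (series (perimeter_term (u_plus s) a b s eps)).

Definition L_minus (R : realType) (a b s eps : R) : R :=
  2 * Num.sqrt (a ^+ 2 + b ^+ 2) / - (s - 1) *
  limn (series (perimeter_term (u_minus s) a b s eps)).

(* Main.v *)
(* A chord of the rhombus is controlled by the monotone coordinate x along each
   of the two halves of the curve, which gives the perimeter.

   For the branches, with X = y^nu and 1 / u_k = nu / (tau k + 1), the Pochhammer
   quotients are moments of the unit interval,
     \int_0^1 y^m (1 - X)^n dy = n! / ((m + 1) (u + 1)_n),  u = (m + 1) / nu,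
   so by the binomial series _2F_1(-1/2, 1; u + 1; z) = (m + 1) \int_0^1
   y^m sqrt (1 - z (1 - X)) dy.  Summing over k, again with the binomial series,
   the Abel sums become
     nu \int_0^1 (1 + eps y^tau)^(-alpha) g(X) dy,
     g(X) = sqrt (1 - z (1 - X)) + sqrt (1 - (1 - z) (1 - X)),
   where (nu, tau) = (2 (s - 1), s) for the positive branch and
   (2 (1 - s) / s, 1) for the negative one.  At eps = 1, |g - 2| <= 1 - X shows
   that replacing g by 2 costs at most nu, and nu -> 0 as s -> 1, while
   \int_0^1 (1 + y^tau)^(-alpha) dy is elementary in both cases. *)
Require Import Defs.
From mathcomp Require Import all_boot all_order all_algebra.
From mathcomp Require Import all_classical all_reals all_analysis.
From mathcomp Require Import measurable_realfun ring lra.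
Import Order.TTheory GRing.Theory Num.Theory.
Import numFieldNormedType.Exports.
Local Open Scope classical_set_scope.
Local Open Scope ring_scope.

Set Implicit Arguments.
Unset Strict Implicit.
Unset Printing Implicit Defensive.

(** * The perimeter of the rhombus *)

Section rhombus_perimeter.
Variables (R : realType) (a b : R).
Hypotheses (a0 : 0 < a) (b0 : 0 < b).

Let N (t : R) := `|cos t| / a + `|sin t| / b.
Let x (t : R) := (superellipse 1 a b t).1.
Let y (t : R) := (superellipse 1 a b t).2.

Let N_gt0 t : 0 < N t.
Proof.
have ca : 0 <= `|cos t| / a by rewrite divr_ge0// ltW.
have sb : 0 <= `|sin t| / b by rewrite divr_ge0// ltW.
rewrite lt_neqAle addr_ge0// andbT eq_sym paddr_eq0// !mulf_eq0 !invr_eq0.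
rewrite (gt_eqF a0) (gt_eqF b0) !orbF !normr_eq0; apply/negP => /andP[/eqP c /eqP s].
by have := cos2Dsin2 t; rewrite c s !expr0n addr0 => /eqP; rewrite eq_sym oner_eq0.
Qed.

Let radiusE t : superellipse_radius 1 a b t = (N t)^-1.
Proof.
rewrite /superellipse_radius !powRr1// ?ltW// invr1 powR_inv1//.
exact/ltW/N_gt0.
Qed.

Let xE t : x t = cos t / N t.
Proof. by rewrite /x /= radiusE mulrC. Qed.

Let yE t : y t = sin t / N t.
Proof. by rewrite /y /= radiusE mulrC. Qed.

(** The equation [|x| / a + |y| / b = 1] of the rhombus, solved for [|y|]: dividing by [N t]
    normalises exactly this sum to 1. *)
Let rhombusE t : `|y t| = b * (1 - `|x t| / a).
Proof.
have N0 := N_gt0 t.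
rewrite xE yE !normrM !normfV !(gtr0_norm N0).
have Nn : N t != 0 by rewrite gt_eqF.
have -> : `|sin t| = b * (N t - `|cos t| / a).
  by rewrite /N addrC addKr mulrCA divff ?mulr1// gt_eqF.
by field; rewrite Nn gt_eqF.
Qed.

Let norm_x_le t : `|x t| <= a.
Proof.
have := normr_ge0 (y t); rewrite rhombusE pmulr_rge0// subr_ge0.
by rewrite ler_pdivrMr// mul1r.
Qed.

(** After cross-multiplication by [N t1] and [N t2] the inequality splits: the [1 / a] part follows
    from [cos t2 <= cos t1], the [1 / b] part is [0 <= sin (t2 - t1)]. *)
Let x_upper t1 t2 : 0 <= t1 -> t1 <= t2 -> t2 <= pi -> x t2 <= x t1.
Proof.
move=> t10 t12 t2pi; rewrite !xE ler_pdivrMr// mulrAC ler_pdivlMr//.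
have cc : cos t2 <= cos t1.
  rewrite leNgt ltr_cos -?leNgt// in_itv/=; apply/andP; split=> //.
    exact: le_trans t12.
  exact: le_trans t2pi.
have s12 : 0 <= sin (t2 - t1).
  apply: sin_ge0_pi; rewrite subr_ge0 t12/= lerBlDr.
  by apply: (le_trans t2pi); rewrite lerDl.
have s1 : 0 <= sin t1 by apply: sin_ge0_pi; rewrite t10 (le_trans t12).
have s2 : 0 <= sin t2 by apply: sin_ge0_pi; rewrite t2pi (le_trans t10).
rewrite /N (ger0_norm s1) (ger0_norm s2) !mulrDr; apply: lerD.
  rewrite !mulrA ler_pM2r ?invr_gt0//.
  by case: (ger0P (cos t1)) => ?; case: (ger0P (cos t2)) => ?; nra.
by rewrite !mulrA ler_pM2r ?invr_gt0//; move: s12; rewrite sinB; nra.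
Qed.

(** Central symmetry, which carries facts about the upper half of the curve over to the lower
    half. *)
Let xDpi t : x (t + pi) = - x t.
Proof. by rewrite !xE /N sinDpi cosDpi !normrN mulNr. Qed.

Let yDpi t : y (t + pi) = - y t.
Proof. by rewrite !yE /N sinDpi cosDpi !normrN mulNr. Qed.

Let x_lower t1 t2 : pi <= t1 -> t1 <= t2 -> t2 <= 2 * pi -> x t1 <= x t2.
Proof.
move=> t10 t12 t2pi; rewrite -(subrK pi t1) -(subrK pi t2) !xDpi lerN2.
by apply: x_upper; lra.
Qed.

Let y_upper t : 0 <= t <= pi -> y t = b * (1 - `|x t| / a).
Proof.
move=> /sin_ge0_pi s0; rewrite -rhombusE ger0_norm// yE divr_ge0//.
exact/ltW/N_gt0.
Qed.

Let y_lower t : pi <= t <= 2 * pi -> y t = - (b * (1 - `|x t| / a)).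
Proof.
move=> tpi; rewrite -(subrK pi t) yDpi xDpi normrN y_upper//; lra.
Qed.

(* [V] times [sqrt (1 + (b / a)^2)] is the arc length along the rhombus. *)
Let V (t : R) := if t <= pi then a - x t else 3 * a + x t.

(** The offset [3 * a] makes both formulas of [V] agree at [pi], where [x] is [- a]. Within one half
    of the curve [V] grows by exactly [|x t2 - x t1|], and [y] is Lipschitz in [x] with constant
    [b / a]. *)
Let V_control t1 t2 : 0 <= t1 -> t1 <= t2 -> t2 <= 2 * pi ->
  `|x t2 - x t1| <= V t2 - V t1 /\ `|y t2 - y t1| <= b / a * (V t2 - V t1).
Proof.
move=> t10 t12 t2pi; rewrite /V.
have x1a := norm_x_le t1; have x2a := norm_x_le t2.
have lip (u v : R) : `|b * (1 - `|u| / a) - b * (1 - `|v| / a)| <= b / a * `|u - v|.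
  have -> : b * (1 - `|u| / a) - b * (1 - `|v| / a) = b / a * (`|v| - `|u|).
    by field; rewrite gt_eqF.
  rewrite normrM gtr0_norm ?divr_gt0// ler_pM2l ?divr_gt0//.
  by rewrite [leRHS]distrC; exact: ler_dist_dist.
have [t2le|t2gt] := leP t2 pi.
  have t1le := le_trans t12 t2le; rewrite t1le.
  have xx := x_upper t10 t12 t2le.
  have -> : a - x t2 - (a - x t1) = `|x t2 - x t1|.
    by rewrite ler0_norm ?subr_le0//; ring.
  split=> //; rewrite !y_upper// ?t2le ?t1le ?t10 ?(le_trans t10 t12)//.
(* If [t1 <= pi < t2], the increment of [V] is the sum of the horizontal distances of both endpoints
   to the vertex [(- a, 0)], and each [|y|] is at most [b / a] times its own distance. *)
have [t1le|t1gt] := leP t1 pi.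
  have -> : 3 * a + x t2 - (a - x t1) = (a + x t2) + (a + x t1) by ring.
  have /andP[x1l x1r] : -a <= x t1 <= a by rewrite -ler_norml.
  have /andP[x2l x2r] : -a <= x t2 <= a by rewrite -ler_norml.
  split; first by rewrite ler_norml; apply/andP; split; lra.
  rewrite (y_upper (t := t1)) ?t10// (y_lower (t := t2)) ?t2pi ?(ltW t2gt)//.
  have yle (u : R) : `|u| <= a -> 0 <= b * (1 - `|u| / a) <= b / a * (a + u).
    move=> ua; apply/andP; split.
      by rewrite mulr_ge0 ?(ltW b0)// subr_ge0 ler_pdivrMr// mul1r.
    have -> : b * (1 - `|u| / a) = b / a * (a - `|u|) by field; rewrite gt_eqF.
    rewrite ler_pM2l ?divr_gt0// lerD2l lerNl -normrN; exact: ler_norm.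
  have /andP[y1l y1r] := yle _ x1a; have /andP[y2l y2r] := yle _ x2a.
  by rewrite mulrDr ler_norml; apply/andP; split; lra.
have xx := x_lower (ltW t1gt) t12 t2pi.
have -> : 3 * a + x t2 - (3 * a + x t1) = `|x t2 - x t1|.
  by rewrite ger0_norm ?subr_ge0//; ring.
split=> //; rewrite !y_lower ?t2pi ?(ltW t2gt) ?(ltW t1gt) ?(le_trans t12 t2pi)//.
by rewrite -opprD normrN; exact: lip.
Qed.

Let c := Num.sqrt (a ^+ 2 + b ^+ 2).

Let chord_le (u v w : R) : `|u| <= w -> `|v| <= b / a * w ->
  Num.sqrt (u ^+ 2 + v ^+ 2) <= c / a * w.
Proof.
move=> uw vw; have w0 : 0 <= w by rewrite (le_trans _ uw).
have cw : 0 <= c / a * w by rewrite mulr_ge0// divr_ge0 ?sqrtr_ge0// ltW.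
rewrite -(ler_pXn2r (n := 2)) ?nnegrE ?sqrtr_ge0// sqr_sqrtr ?addr_ge0 ?sqr_ge0//.
rewrite 2!exprMn sqr_sqrtr ?addr_ge0 ?sqr_ge0//.
have -> : (a ^+ 2 + b ^+ 2) * a^-1 ^+ 2 * w ^+ 2 = w ^+ 2 + (b / a * w) ^+ 2.
  by field; rewrite gt_eqF.
by apply: lerD; rewrite -real_normK ?num_real// lerXn2r ?nnegrE// (le_trans _ vw).
Qed.

(** Each chord is at most [c / a] times an increment of [V], and the increments telescope to
    [V (2 * pi) - V 0 = 4 * a]. *)
Let inscribed_length_le s : itv_partition 0 (2 * pi) s ->
  inscribed_length (superellipse 1 a b) 0 (2 * pi) s <= 4 * c.
Proof.
move=> ps; rewrite /inscribed_length.
set t := nth (2 * pi) (0 :: s).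
apply: (@le_trans _ _ (\sum_(0 <= n < size s) c / a * (V (t n.+1) - V (t n)))).
  apply: ler_sum_nat => n /andP[_ ns].
  have t0 : 0 <= t n by apply: itv_partition_nth_ge => //; exact: ltnW.
  have t2 : t n.+1 <= 2 * pi by exact: itv_partition_nth_le.
  have t12 : t n <= t n.+1.
    by apply: (nondecreasing_fun_itv_partition (f := id) _ ps ns) => u v _ _.
  have [dx dy] := V_control t0 t12 t2.
  exact: chord_le.
rewrite -mulr_sumr telescope_sumr// /t (itv_partition_nth_size _ ps) /= /V pi_ge0.
have -> : (2 * pi <= pi :> R) = false.
  by apply/negbTE; rewrite -ltNge; have := pi_gt0 R; lra.
rewrite !xE /N [2 * pi]mulr_natl cos2pi sin2pi cos0 sin0 normr0 normr1 mul0r addr0 !mul1r invrK.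
rewrite le_eqVlt; apply/orP; left; apply/eqP.
by field; rewrite gt_eqF.
Qed.

(** Together with 0 these are the parameters of the vertices: the inscribed polygon is the rhombus
    itself and attains the upper bound. The form [pi / 2 + pi] matches the symmetry lemmas. *)
Let quarter_partition : seq R := [:: pi / 2; pi; pi / 2 + pi; 2 * pi].

Let quarter_partitionP : itv_partition (0 : R) (2 * pi) quarter_partition.
Proof.
have := pi_gt0 R; split=> //=.
by rewrite andbT; apply/and4P; split; lra.
Qed.

Let inscribed_length_quarter :
  inscribed_length (superellipse 1 a b) 0 (2 * pi) quarter_partition = 4 * c.
Proof.
pose t := nth (2 * pi) (0 :: quarter_partition).
rewrite -[LHS]/(\sum_(0 <= n < 4)
  Num.sqrt ((x (t n.+1) - x (t n)) ^+ 2 + (y (t n.+1) - y (t n)) ^+ 2)).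
rewrite !big_nat_recl// big_nil.
rewrite /t -[nth _ _ 0]/0 -[nth _ _ 1]/(pi / 2) -[nth _ _ 2]/pi.
rewrite -[nth _ _ 3]/(pi / 2 + pi) -[nth _ _ 4]/(2 * pi).
have x0 : x 0 = a by rewrite xE /N cos0 sin0 normr0 normr1 mul0r addr0 !mul1r invrK.
have y0 : y 0 = 0 by rewrite yE sin0 mul0r.
have xh : x (pi / 2) = 0 by rewrite xE cos_pihalf mul0r.
have yh : y (pi / 2) = b.
  by rewrite yE /N cos_pihalf sin_pihalf normr0 normr1 mul0r add0r !mul1r invrK.
have xpi : x pi = - a by rewrite -(add0r pi) xDpi x0.
have ypi : y pi = 0 by rewrite -(add0r pi) yDpi y0 oppr0.
have x2pi : x (2 * pi) = a by rewrite [2 * pi]mulr_natl mulr2n xDpi xpi opprK.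
have y2pi : y (2 * pi) = 0 by rewrite [2 * pi]mulr_natl mulr2n yDpi ypi oppr0.
rewrite xDpi yDpi x0 y0 xh yh xpi ypi x2pi y2pi.
rewrite !(sub0r, subr0, oppr0, opprK, sqrrN, add0r, addr0).
by rewrite /c; ring.
Qed.

Lemma superellipse_perimeter1 :
  superellipse_perimeter 1 a b = (4 * Num.sqrt (a ^+ 2 + b ^+ 2))%:E.
Proof.
apply/eqP; rewrite eq_le; apply/andP; split.
  by apply: ge_ereal_sup => _ [s ps <-]; rewrite lee_fin inscribed_length_le.
rewrite -/c -inscribed_length_quarter; apply: ereal_sup_ubound.
by exists quarter_partition.
Qed.

End rhombus_perimeter.

(** * Continuity on a subset under sums, products and composition *)

Section within_continuous.
Variables (R : realType) (A : set R).
Implicit Types f g : R -> R.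

Lemma within_continuousD f g : {within A, continuous f} ->
  {within A, continuous g} -> {within A, continuous (fun x => f x + g x)}.
Proof. by move=> cf cg x; apply: continuousD; [exact: cf|exact: cg]. Qed.

Lemma within_continuousM f g : {within A, continuous f} ->
  {within A, continuous g} -> {within A, continuous (fun x => f x * g x)}.
Proof. by move=> cf cg x; apply: continuousM; [exact: cf|exact: cg]. Qed.

Lemma within_continuous_comp f g : (forall x, {for f x, continuous g}) ->
  {within A, continuous f} -> {within A, continuous (fun x => g (f x))}.
Proof. by move=> cg cf x; apply: continuous_comp; [exact: cf|exact: cg]. Qed.

Lemma within_continuous_cst (c : R) : {within A, continuous (fun=> c)}.
Proof. exact/continuous_subspaceT/cst_continuous. Qed.

End within_continuous.

(** * The Gamma function and the Pochhammer symbol *)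

Section Gamma_theory.
Variable R : realType.
Implicit Types (x t : R) (n : nat).
Local Notation mu := (@lebesgue_measure R).

Let k x t : R := t `^ (x - 1) * expR (- t).

(** The value stays in the extended reals because the functional equation is proved before
    finiteness, which is then deduced from it. *)
Let I x : \bar R := (\int[mu]_(t in `]0%R, +oo[) (k x t)%:E)%E.

Let continuous_expRN : continuous (fun t => expR (- t)).
Proof.
by move=> t; apply: continuous_comp; [exact: continuousN|exact: continuous_expR].
Qed.

Let measurable_k x (D : set R) : measurable_fun D (k x).
Proof.
apply: measurable_funM; apply: measurable_funTS; first exact: measurable_powR.
exact: continuous_measurable_fun.
Qed.

Let measurable_Ek x (D : set R) : measurable_fun D (EFin \o k x).
Proof. by apply/measurable_EFinP; exact: measurable_k. Qed.

Let k_ge0 x t : 0 <= k x t.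
Proof. by rewrite mulr_ge0 ?powR_ge0 ?expR_ge0. Qed.

Let is_derive_NexpRN t : is_derive t 1 (fun t : R => - expR (- t)) (expR (- t)).
Proof. by apply: is_derive_eq; rewrite /GRing.scale/= mulrN1 opprK. Qed.

Let within_continuous_powR c d x : 0 < c ->
  {within `[c, d], continuous (fun t => t `^ x)}.
Proof.
move=> c0; apply: derivable_within_continuous => t; rewrite in_itv/= => /andP[ct _].
by apply: derivable_powR; rewrite in_itv/= andbT (lt_le_trans c0).
Qed.

Let by_parts c d x : 0 < c -> c < d ->
  (\int[mu]_(t in `[c, d]) (k (x + 1) t)%:E =
   (c `^ x * expR (- c) - d `^ x * expR (- d))%:E +
   x%:E * \int[mu]_(t in `[c, d]) (k x t)%:E)%E.
Proof.
move=> c0 cd.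
have LR (f : R -> R) : {in `[c, d], forall t, derivable f t 1} ->
    derivable_oo_LRcontinuous f c d.
  move=> df; split.
  - by move=> t tcd; apply: df; apply: subset_itv_oo_cc tcd.
  - apply: cvg_at_right_filter; apply: differentiable_continuous.
    by apply/derivable1_diffP/df; rewrite in_itv/= lexx ltW.
  - apply: cvg_at_left_filter; apply: differentiable_continuous.
    by apply/derivable1_diffP/df; rewrite in_itv/= lexx ltW.
under eq_integral do rewrite /k addrK.
rewrite (@integration_by_parts _ _ (fun t => - expR (- t))
  (fun t => x * t `^ (x - 1)) (fun t => expR (- t)))//.
- have ik : mu.-integrable `[c, d] (EFin \o k x).
    apply: continuous_compact_integrable; first exact: segment_compact.
    apply: within_continuousM; first exact: within_continuous_powR.
    exact/continuous_subspaceT.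
  rewrite (_ : (fun t => _) = (fun t => (- x)%:E * (k x t)%:E)%E); last first.
    by apply/funext => t; rewrite -EFinM /k; congr EFin; ring.
  rewrite integralZl// EFinN mulNe oppeK; congr (_%:E + _)%E; ring.
- apply: within_continuousM; first exact: within_continuous_cst.
  exact: within_continuous_powR.
- apply: LR => t; rewrite in_itv/= => /andP[ct _].
  by apply: derivable_powR; rewrite in_itv/= andbT (lt_le_trans c0).
- move=> t; rewrite in_itv/= => /andP[ct _].
  by rewrite powR_derive1// in_itv/= andbT (lt_trans c0).
- exact/continuous_subspaceT.
- by apply: LR => t _; have [] := is_derive_NexpRN t.
- by move=> t _; rewrite derive1E; have [_ ->] := is_derive_NexpRN t.
Qed.

(** An exhaustion of the half-line by compact intervals away from 0, on which integration by parts
    applies. Using [n.+2] keeps the interval nondegenerate at [n = 0]. *)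
Let E n : set R := `[n.+2%:R^-1, n.+2%:R].

Let bigcup_E : \bigcup_n E n = `]0, +oo[%classic.
Proof.
apply/seteqP; split => [t [n _]|t]; rewrite /E /= !in_itv/= ?andbT.
  by move=> /andP[+ _]; apply: lt_le_trans; rewrite invr_gt0.
move=> t0; exists (Num.bound t + Num.bound t^-1)%N => //=.
have bt := archi_boundP (ltW t0).
have tV0 : 0 < t^-1 by rewrite invr_gt0.
have btV := archi_boundP (ltW tV0).
rewrite in_itv/=; apply/andP; split.
  rewrite -[leRHS]invrK lef_pV2 ?posrE//.
  by apply: (le_trans (ltW btV)); rewrite ler_nat; exact: leqW (leqW (leq_addl _ _)).
by apply: (le_trans (ltW bt)); rewrite ler_nat; exact: leqW (leqW (leq_addr _ _)).
Qed.

Let cvg_E x : (\int[mu]_(t in E n) (k x t)%:E @[n --> \oo] --> I x)%E.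
Proof.
rewrite /I -bigcup_E; apply: ge0_nondecreasing_set_cvg_integral => //.
- apply/nondecreasing_seqP => n; rewrite subsetEset; apply: subset_itv; rewrite bnd_simp.
    by rewrite lef_pV2 ?posrE// ler_nat.
  by rewrite ler_nat.
- by move=> n; rewrite /E.
- by move=> n; exact: measurable_Ek.
- by move=> n t _; rewrite lee_fin.
Qed.

(** Trades a real exponent for an integer one: 1 is the bound up to [t = 1], and [t ^+ n] beyond. *)
Let powR_le1D n x t : 0 <= x -> x <= n%:R -> 0 <= t -> t `^ x <= 1 + t ^+ n.
Proof.
move=> x0 xn t0; rewrite -powR_mulrn//.
have [t1|t1] := leP t 1.
  apply: (@le_trans _ _ 1); last by rewrite lerDl powR_ge0.
  have -> : 1 = 1 `^ x by rewrite powR1.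
  by rewrite ge0_ler_powR ?nnegrE.
apply: (@le_trans _ _ (t `^ n%:R)); first by rewrite ler_powR// ltW.
by rewrite lerDr.
Qed.

(** The exponential wins through its Taylor term of order [N + 1]: the power of [t] times one more
    factor [t] is at most [t + t ^+ N], hence at most [1 + (N + 1)!] times [expR t]. The extra
    factor [t] yields the decay. *)
Let powR_cvg0_at_infty x : 0 < x ->
  n.+2%:R `^ x * expR (- n.+2%:R) @[n --> \oo] --> (0 : R).
Proof.
move=> x0; pose N := (Num.bound x).+1.
have N0 : 0 <= N.+1`!%:R :> R by [].
apply: (@squeeze_cvgr _ _ _ _ (fun=> 0) (fun n => (1 + N.+1`!%:R) / n.+1%:R)).
- near=> n; rewrite mulr_ge0 ?powR_ge0 ?expR_ge0//=.
  have t0 : 0 < n.+2%:R :> R by [].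
  set t := n.+2%:R in t0 *.
  have tn : n.+1%:R <= t by rewrite ler_nat.
  apply: (@le_trans _ _ ((1 + N.+1`!%:R) / t)); last first.
    by rewrite ler_wpM2l ?addr_ge0// lef_pV2 ?posrE.
  rewrite expRN ler_pdivlMr// mulrAC ler_pdivrMr ?expR_gt0//.
  have xN : x <= N.-1%:R by exact/ltW/archi_boundP/ltW.
  apply: (@le_trans _ _ ((1 + t ^+ N.-1) * t)).
    by rewrite ler_pM2r// powR_le1D// ltW.
  have t1 : 1 <= t by rewrite ler1n.
  have e1 := expR_ge1Dx t.
  have fN : 0 < N.+1`!%:R :> R by rewrite ltr0n fact_gt0.
  have eN : t ^+ N.+1 <= expR t * N.+1`!%:R.
    by rewrite -ler_pdivrMr//; have := expR_ge1Dxn N (ltW t0); lra.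
  have tN : t ^+ N <= t ^+ N.+1 by rewrite exprS ler_peMl// exprn_ge0// ltW.
  rewrite mulrDl mul1r -exprSr -[N.-1.+1]/N; lra.
- exact: cvg_cst.
- rewrite -[X in _ --> X](mulr0 (1 + N.+1`!%:R)).
  by apply: cvgMr; exact: cvg_harmonic.
Unshelve. all: by end_near. Qed.

Let powR_cvg0_at_0 x : 0 < x ->
  (n.+2%:R^-1) `^ x * expR (- n.+2%:R^-1) @[n --> \oo] --> (0 : R).
Proof.
move=> x0.
have h0 : (n.+2%:R^-1 : R) @[n --> \oo] --> (0 : R).
  by have := @cvg_harmonic R; rewrite -cvg_shiftS.
rewrite -[X in _ --> X](mul0r (expR (- 0))); apply: cvgM.
  by have /cvg_at_rightP := powR_cvg0 x0; apply; split.
exact: (cvg_comp _ _ h0 (@continuous_expRN 0)).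
Qed.

(** Integration by parts on [E n], in the limit: for [0 < x] the boundary terms vanish at both
    ends. *)
Let I_rec x : 0 < x -> I (x + 1) = (x%:E * I x)%E.
Proof.
move=> x0; apply: (cvg_unique _ (@cvg_E (x + 1))) => //.
rewrite -[(x%:E * _)%E]add0e.
have -> : (fun n => \int[mu]_(t in E n) (k (x + 1) t)%:E)%E =
  (fun n => ((n.+2%:R^-1) `^ x * expR (- n.+2%:R^-1) -
             n.+2%:R `^ x * expR (- n.+2%:R))%:E +
   x%:E * \int[mu]_(t in E n) (k x t)%:E)%E.
  apply/funext => n; rewrite by_parts ?invr_gt0//.
  by rewrite (@lt_trans _ _ 1)// ?ltr1n// invf_lt1// ltr1n.
apply: cvgeD => //.
  apply: cvg_EFin; first exact: nearW.
  rewrite -[X in _ --> X](subr0 0); apply: cvgB.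
  - exact: powR_cvg0_at_0.
  - exact: powR_cvg0_at_infty.
exact: cvgeZl.
Qed.

Let I_ge0 x : (0 <= I x)%E.
Proof. by apply: integral_ge0 => t _; rewrite lee_fin. Qed.

Let I1_lty : (I 1 < +oo)%E.
Proof.
rewrite /I integral_itv_obnd_cbnd; last exact: measurable_Ek.
rewrite (@ge0_continuous_FTC2y _ _ (fun t => - expR (- t)) 0 0) ?ltry//.
- have -> : k 1 = fun t => expR (- t).
    by apply/funext => t; rewrite /k subrr powRr0 mul1r.
  exact/continuous_subspaceT.
- by rewrite -[X in _ --> X]oppr0; apply: cvgN; exact: cvgr_expR.
- by apply: cvg_at_right_filter; apply: cvgN; exact: continuous_expRN.
- move=> t _; rewrite derive1E; have [_ ->] := is_derive_NexpRN t.
  by rewrite /k subrr powRr0 mul1r.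
Qed.

Let I_nat_lty n : (I n.+1%:R < +oo)%E.
Proof.
elim: n => [|n IHn]; first exact: I1_lty.
by rewrite -natr1 I_rec// lte_mul_pinfty.
Qed.

(** The functional equation moves the question to [x + 1], where the exponent [x] is positive and
    the integrand is at most the sum of those of [I 1] and [I n.+1%:R], both finite. *)
Let I_lty x : 0 < x -> (I x < +oo)%E.
Proof.
move=> x0; suff : (I (x + 1) < +oo)%E.
  rewrite (I_rec x0) !ltey; apply: contra => /eqP ->.
  by rewrite gt0_muley ?lte_fin.
pose n := Num.bound x.
apply: (@le_lt_trans _ _ (I 1 + I n.+1%:R)%E).
  2: exact: lte_add_pinfty I1_lty (I_nat_lty n).
rewrite /I -ge0_integralD//=; try exact: measurable_Ek.
- apply: ge0_le_integral => //=.
  + by move=> t _; rewrite lee_fin.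
  + exact: measurable_Ek.
  + by apply: emeasurable_funD; exact: measurable_Ek.
  + move=> t; rewrite in_itv/= andbT => t0.
    rewrite lee_fin /k addrK -natr1 addrK subrr powRr0 -mulrDl.
    rewrite ler_wpM2r ?expR_ge0// powR_mulrn ?powR_le1D ?(ltW t0) ?(ltW x0)//.
    exact/ltW/archi_boundP/ltW.
- by move=> t _; rewrite lee_fin.
- by move=> t _; rewrite lee_fin.
Qed.

(** Again through [x + 1]: its integrand is at least [expR (- 2)] on the interval from 1 to 2. *)
Let I_gt0 x : 0 < x -> (0 < I x)%E.
Proof.
move=> x0; suff : (0 < I (x + 1))%E.
  by rewrite I_rec// pmule_rgt0// lte_fin.
apply: (@lt_le_trans _ _ (\int[mu]_(t in `[1%R, 2%R]) (expR (- 2))%:E)%E).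
  rewrite integral_cst//= lebesgue_measure_itv/= lte_fin ltr1n/=.
  by rewrite -EFinB -EFinM lte_fin mulr_gt0 ?expR_gt0//; lra.
apply: (@le_trans _ _ (\int[mu]_(t in `[1%R, 2%R]) (k (x + 1) t)%:E)%E).
  apply: ge0_le_integral => //=.
  - exact: measurable_Ek.
  - move=> t; rewrite in_itv/= => /andP[t1 t2]; rewrite lee_fin /k addrK.
    rewrite -[leLHS]mul1r ler_pM ?expR_ge0// ?ler_expR ?lerN2//.
    have -> : 1 = 1 `^ x by rewrite powR1.
    apply: ge0_ler_powR; [exact: ltW|by rewrite nnegrE| |exact: t1].
    by rewrite nnegrE; apply: le_trans t1.
apply: ge0_subset_integral => //=; first exact: measurable_Ek.
  by move=> t _; rewrite lee_fin.
by move=> t /=; rewrite !in_itv/= andbT => /andP[+ _]; exact: lt_le_trans.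
Qed.

Lemma Gamma_EulerD1 x : 0 < x -> Gamma_Euler (x + 1) = x * Gamma_Euler x.
Proof.
move=> x0; rewrite -[LHS]/(fine (I (x + 1))) -[Gamma_Euler x]/(fine (I x)) (I_rec x0).
apply: fineM => //; rewrite (ge0_fin_numE (I_ge0 x)); exact: I_lty.
Qed.

Lemma Gamma_Euler_gt0 x : 0 < x -> 0 < Gamma_Euler x.
Proof.
move=> x0; rewrite -[ltRHS]/(fine (I x)); apply: fine_gt0.
by apply/andP; split; [exact: I_gt0|exact: I_lty].
Qed.

(** The form of the Pochhammer symbol without Gamma; it is also the denominator in the continuation
    of [Gamma]. *)
Definition rising x n := \prod_(0 <= i < n) (x + i%:R).

Lemma rising0 x : rising x 0 = 1.
Proof. by rewrite /rising big_geq. Qed.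

Lemma risingS x n : rising x n.+1 = rising x n * (x + n%:R).
Proof. by rewrite /rising big_nat_recr. Qed.

Lemma risingD x m n : rising x (m + n)%N = rising x m * rising (x + m%:R) n.
Proof.
elim: n => [|n IHn]; first by rewrite addn0 rising0 mulr1.
by rewrite addnS !risingS IHn natrD -mulrA addrA.
Qed.

Lemma rising_neq0 x n : (forall i : nat, x + i%:R != 0) -> rising x n != 0.
Proof. by move=> x0; rewrite /rising prodf_seq_neq0; apply/allP => i _; exact: x0. Qed.

Lemma rising_gt0 x n : 0 < x -> 0 < rising x n.
Proof. by move=> x0; apply: prodr_gt0 => i _; exact: ltr_wpDr. Qed.

Lemma rising1 n : rising 1 n = n`!%:R.
Proof.
elim: n => [|n IHn]; first by rewrite rising0.
by rewrite risingS IHn factS natrM mulrC nat1r.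
Qed.

Lemma Gamma_EulerDn x n : 0 < x ->
  Gamma_Euler (x + n%:R) = rising x n * Gamma_Euler x.
Proof.
move=> x0; elim: n => [|n IHn]; first by rewrite addr0 rising0 mul1r.
have xn : 0 < x + n%:R by rewrite ltr_wpDr.
by rewrite -natr1 addrA (Gamma_EulerD1 xn) IHn risingS mulrCA mulrA.
Qed.

(** The shift [Num.bound x] chosen in [Gamma] is immaterial: enlarging an admissible shift
    multiplies numerator and denominator by the same rising factorial. *)
Lemma GammaE x n : 0 < x + n%:R -> (forall i : nat, x + i%:R != 0) ->
  Gamma x = Gamma_Euler (x + n%:R) / rising x n.
Proof.
move=> xn x0; rewrite /Gamma; case: ifPn => [x_gt0|].
  by rewrite Gamma_EulerDn// mulrAC divff ?mul1r// rising_neq0.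
rewrite -leNgt => x_le0; rewrite -/(rising x _).
have shift m p : 0 < x + m%:R -> (m <= p)%N ->
    Gamma_Euler (x + p%:R) / rising x p = Gamma_Euler (x + m%:R) / rising x m.
  move=> xm /subnKC <-; rewrite natrD addrA (@Gamma_EulerDn (x + m%:R))// risingD.
  have xm0 i : x + m%:R + i%:R != 0 by rewrite gt_eqF// ltr_wpDr.
  by field; rewrite !rising_neq0.
have xN : 0 < x + (Num.bound x)%:R.
  have := archi_boundP (normr_ge0 x); rewrite /Num.bound normr_id.
  by rewrite ler0_norm// -subr_gt0 opprK addrC.
by case: (leqP n (Num.bound x)) => [|/ltnW]; [move=> ?; exact: shift|move=> ?; exact/esym/shift].
Qed.

(** Both Gamma values are written with the common positive argument [x + n + N], whose Euler
    integral cancels. Negative arguments are allowed because the parameter [- 2^-1] occurs below. *)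
Lemma pochhammerE x n : (forall i : nat, x + i%:R != 0) ->
  pochhammer x n = rising x n.
Proof.
move=> x0; rewrite /pochhammer.
have xN : 0 < x + (Num.bound (- x))%:R.
  rewrite -ltrBlDl sub0r; apply: le_lt_trans (ler_norm _) _.
  by have := archi_boundP (normr_ge0 (- x)); rewrite /Num.bound normr_id.
set N := Num.bound _ in xN.
have xNn : 0 < x + n%:R + N%:R by rewrite addrAC ltr_wpDr.
rewrite (@GammaE (x + n%:R) N)//; last by move=> i; rewrite -addrA -natrD.
rewrite (@GammaE x (n + N)%N) ?natrD ?addrA// risingD.
have G0 : Gamma_Euler (x + n%:R + N%:R) != 0 by rewrite gt_eqF// Gamma_Euler_gt0.
have r1 := rising_neq0 n x0.
have r2 : rising (x + n%:R) N != 0.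
  by apply: rising_neq0 => i; rewrite -addrA -natrD.
by field; rewrite G0 r1 r2.
Qed.

End Gamma_theory.

(** * The binomial series *)

Lemma ratio_is_cvg_normed_series (R : realType) (u : R ^nat) (r : R) (N : nat) :
  0 < r < 1 -> (forall n, (N <= n)%N -> `|u n.+1| <= r * `|u n|) ->
  cvgn [normed series u].
Proof.
move=> /andP[r0 r1] ur.
(* With this constant the geometric sequence dominates each of the first [N + 1] terms; beyond them
   the ratio hypothesis propagates the bound. *)
pose C := \sum_(0 <= i < N.+1) `|u i| / r ^+ i.
have C0 : 0 <= C by apply: sumr_ge0 => i _; rewrite divr_ge0// exprn_ge0// ltW.
have uC n : `|u n| <= geometric C r n.
  have small m : (m <= N)%N -> `|u m| <= C * r ^+ m.
    move=> mN; rewrite -ler_pdivrMr ?exprn_gt0// /C.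
    have mi : m \in index_iota 0 N.+1 by rewrite mem_index_iota.
    rewrite (bigD1_seq m mi (iota_uniq _ _))/= lerDl.
    by apply: sumr_ge0 => i _; rewrite divr_ge0// exprn_ge0// ltW.
  elim: n => [|n IHn]; first exact: small.
  have [nN|Nn] := ltnP n N; first exact: small.
  by rewrite /= exprS mulrCA (le_trans (ur _ Nn))// ler_pM2l.
apply: series_le_cvg uC _ => // [n|].
  by rewrite geometric_ge0// ltW.
by apply: is_cvg_geometric_series; rewrite ger0_norm// ltW.
Qed.

Section binomial_series.
Variable R : realType.
Implicit Types (q x : R) (n : nat).

(** The Taylor coefficients at 0 of the power [- q] of [1 - x]; this sign convention makes them
    [(q)_n / n!]. *)
Definition binomial_coeff q n : R := rising q n / n`!%:R.
Arguments binomial_coeff : simpl never.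

Lemma binomial_coeffS q n :
  n.+1%:R * binomial_coeff q n.+1 = (q + n%:R) * binomial_coeff q n.
Proof.
rewrite /binomial_coeff risingS factS natrM invfM.
by rewrite mulrCA mulVKf//; ring.
Qed.

Lemma binomial_coeff_diffs q n :
  pseries_diffs (binomial_coeff q) n = q * binomial_coeff (q + 1) n.
Proof.
rewrite /pseries_diffs /binomial_coeff -add1n risingD add1n factS natrM.
by rewrite risingS rising0 mul1r addr0 invfM mulrCA mulVKf// mulrA.
Qed.

Lemma is_cvg_normed_binomial_series q x : `|x| < 1 ->
  cvgn [normed pseries (binomial_coeff q) x].
Proof.
(* The ratio of successive terms tends to [|x|], so the midpoint [r] of [|x|] and 1 bounds it as
   soon as [|q| < (r - |x|) * n]; this fixes [N]. *)
move=> x1; have x0 := normr_ge0 x; pose r := (1 + `|x|) / 2.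
have rx : 0 < r - `|x| by rewrite /r; lra.
have qN := archi_boundP (divr_ge0 (normr_ge0 q) (ltW rx)).
set N := Num.bound _ in qN.
apply: (@ratio_is_cvg_normed_series _ _ r N) => [|n Nn /=]; first by rewrite /r; lra.
have -> : binomial_coeff q n.+1 * x ^+ n.+1 =
    (q + n%:R) * x / n.+1%:R * (binomial_coeff q n * x ^+ n).
  rewrite -[binomial_coeff q n.+1](mulKf (_ : n.+1%:R != 0))//.
  by rewrite binomial_coeffS exprS; ring.
rewrite normrM ler_wpM2r// !normrM normfV normr_nat ler_pdivrMr//.
have qn : `|q| < (r - `|x|) * n%:R.
  rewrite mulrC -ltr_pdivrMr// (lt_le_trans qN)// ler_nat//.
apply: (@le_trans _ _ ((`|q| + n%:R) * `|x|)).
  by rewrite ler_wpM2r// (le_trans (ler_normD _ _))// normr_nat.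
rewrite -natr1; have := normr_ge0 q; rewrite /r in rx qn *; nra.
Qed.

Lemma is_cvg_binomial_series q x : `|x| < 1 ->
  cvgn (pseries (binomial_coeff q) x).
Proof. by move=> x1; apply: normed_cvg; exact: is_cvg_normed_binomial_series. Qed.

Let f q x := limn (pseries (binomial_coeff q) x).

(** Termwise differentiation turns the coefficients for [q] into [q] times those for [q + 1]. The
    point [K] lies strictly between [|x|] and 1, so all the series involved converge there. *)
Let is_derive_f q x : `|x| < 1 -> is_derive x 1 (f q) (q * f (q + 1) x).
Proof.
move=> x1; have x0 := normr_ge0 x; pose K := (1 + `|x|) / 2.
have K0 : 0 <= K by rewrite /K; lra.
have K1 : `|K| < 1 by rewrite ger0_norm// /K; lra.
have xK : `|x| < `|K| by rewrite (ger0_norm K0) /K; lra.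
have diffs p : pseries_diffs (binomial_coeff p) = p *: binomial_coeff (p + 1).
  by apply/funext => n; rewrite binomial_coeff_diffs.
have seriesZl p c y : pseries (c *: binomial_coeff p) y = c *: pseries (binomial_coeff p) y.
  rewrite /pseries -seriesZ; congr series; apply/funext => n.
  exact/esym/mulrA.
have := @pseries_snd_diffs _ (binomial_coeff q) K x.
have -> : pseries_diffs (pseries_diffs (binomial_coeff q)) =
    (q * (q + 1)) *: binomial_coeff (q + 1 + 1).
  rewrite diffs; apply/funext => n.
  transitivity (q * pseries_diffs (binomial_coeff (q + 1)) n); first exact: mulrCA.
  by rewrite binomial_coeff_diffs mulrA.
rewrite diffs !seriesZl.
have -> : limn (q *: pseries (binomial_coeff (q + 1)) x) = q * f (q + 1) x.
  by rewrite limZl_tmp//; exact: is_cvg_binomial_series.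
apply => //; first exact: is_cvg_binomial_series.
- by apply: is_cvgZl_tmp; exact: is_cvg_binomial_series.
- by apply: is_cvgZl_tmp; exact: is_cvg_binomial_series.
Qed.

(** Pascal's rule for the coefficients, summed into a relation between partial sums whose lengths
    differ by one. *)
Let f_pascal q x : `|x| < 1 -> (1 - x) * f (q + 1) x = f q x.
Proof.
move=> x1.
have S n : pseries (binomial_coeff q) x n.+1 =
    pseries (binomial_coeff (q + 1)) x n.+1 - x * pseries (binomial_coeff (q + 1)) x n.
  rewrite /pseries; elim: n => [|n IHn].
    by rewrite /series/= !big_nat1 big_geq// mulr0 subr0 /binomial_coeff !rising0.
  rewrite seriesSr IHn [X in _ = X - _]seriesSr [X in _ = _ - x * X]seriesSr /=.
  have := binomial_coeff_diffs q n; have := binomial_coeffS (q + 1) n.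
  rewrite /pseries_diffs => b1 b0.
  suff -> : binomial_coeff q n.+1 = binomial_coeff (q + 1) n.+1 - binomial_coeff (q + 1) n.
    by rewrite exprS; ring.
  by apply: (mulfI (_ : n.+1%:R != 0)) => //; rewrite mulrBr b0 b1 -natr1; ring.
have cf1 : pseries (binomial_coeff (q + 1)) x @ \oo --> f (q + 1) x.
  exact: is_cvg_binomial_series.
have cf : pseries (binomial_coeff q) x n.+1 @[n --> \oo] --> f q x.
  by rewrite cvg_shiftS; exact: is_cvg_binomial_series.
apply: (cvg_unique _ _ cf) => //; rewrite mulrBl mul1r.
have -> := funext S.
by apply: cvgB; [rewrite cvg_shiftS|exact: cvgMr].
Qed.

(** The two preceding facts give [(1 - y) f' = q f], so [h] has derivative 0 and keeps its value 1
    at 0. *)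
Lemma binomial_series q x : `|x| < 1 ->
  limn (pseries (binomial_coeff q) x) = (1 - x) `^ (- q).
Proof.
move=> x1; rewrite -/(f q x).
pose h y := f q y * (1 - y) `^ q.
have dh (y : R) : `|y| < 1 -> is_derive y 1 h 0.
  move=> y1; have y0 : 0 < 1 - y by rewrite subr_gt0 (le_lt_trans (ler_norm _)).
  have df := is_derive_f q y1.
  have dp : is_derive y 1 (fun y : R => (1 - y) `^ q) (q * (1 - y) `^ (q - 1) * -1).
    have dpow := is_derive1_powR q y0.
    have dsub : is_derive y 1 (fun y : R => 1 - y) (-1).
      by apply: is_derive_eq; rewrite add0r mul1r.
    exact: (@is_derive1_comp _ (fun z => z `^ q) (fun y => 1 - y) y _ _ dpow dsub).
  apply: is_derive_eq; rewrite /GRing.scale/= -(f_pascal q y1).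
  have -> : (1 - y) `^ q = (1 - y) * (1 - y) `^ (q - 1).
    rewrite powRB ?powRr1 ?(ltW y0)//; last by rewrite (gt_eqF y0) implybT.
    by rewrite mulrCA divff ?mulr1// gt_eqF.
  ring.
(* Following [h] along [t * x] with [t] in the unit interval treats both signs of [x] at once. *)
have dhx (t : R) : 0 <= t <= 1 -> is_derive t 1 (fun t => h (t * x)) 0.
  move=> /andP[t0 t1].
  have tx : `|t * x| < 1.
    by rewrite normrM (ger0_norm t0) (le_lt_trans _ x1)// ler_piMl.
  have dtx : is_derive t 1 (fun t : R => t * x) x.
    by apply: is_derive_eq; rewrite /GRing.scale/= mulr0 add0r mulr1.
  by rewrite -(mul0r x); exact: (@is_derive1_comp _ h (fun t => t * x) t _ _ (dh _ tx) dtx).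
have [||t _] := @MVT_segment R (fun t => h (t * x)) (fun=> 0) 0 1 ler01.
- by move=> t; rewrite in_itv/= => /andP[t0 t1]; apply: dhx; rewrite !ltW.
- apply: derivable_within_continuous => t; rewrite in_itv/= => t01.
  by have [] := dhx _ t01.
rewrite !mul0r mul1r => /eqP; rewrite subr_eq0 /h => /eqP.
have -> : f q 0 = 1.
  apply: cvg_lim => //; rewrite -cvg_shiftS.
  rewrite (_ : (fun n => _) = fun=> 1); first exact: cvg_cst.
  apply/funext => n; rewrite /pseries /series/= big_nat_recl//= big1.
    by rewrite addr0 expr0 mulr1 /binomial_coeff rising0 divr1.
  by move=> i _; rewrite expr0n/= mulr0.
have px : (1 - x) `^ q != 0.
  by rewrite gt_eqF// powR_gt0// subr_gt0 (le_lt_trans (ler_norm _)).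
by rewrite subr0 powR1 mulr1 => /(canRL (mulfK px)) ->; rewrite mul1r powRN.
Qed.

End binomial_series.

(** * Integrals over the unit interval *)

Section unit_interval_integral.
Variable R : realType.
Local Notation mu := (@lebesgue_measure R).
Local Notation I01 := (`[0%R, 1%R]%classic : set R).
Implicit Types (f F : R -> R) (m p x y z : R) (n : nat).

Lemma integrable_unit f (M : R) : measurable_fun I01 f ->
  (forall y, 0 <= y <= 1 -> `|f y| <= M) -> mu.-integrable I01 (EFin \o f).
Proof.
move=> mf fM; apply: measurable_bounded_integrable => //.
  by rewrite /= lebesgue_measure_itv/= lte_fin ltr01 -EFinB ltry.
exists M; split; first exact: num_real.
by move=> x Mx y /=; rewrite in_itv/= => /fM /le_trans; apply; exact: ltW.
Qed.

Lemma Rintegral_unit_cst x : \int[mu]_(y in I01) x = x.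
Proof.
rewrite Rintegral_cst//= lebesgue_measure_itv/= lte_fin ltr01.
by rewrite -EFinB/= subr0 mulr1.
Qed.

Lemma normr_Rintegral_unit_le f (M : R) : measurable_fun I01 f ->
  (forall y, 0 <= y <= 1 -> `|f y| <= M) ->
  `|\int[mu]_(y in I01) f y| <= M.
Proof.
move=> mf fM; have fi := integrable_unit mf fM.
rewrite -[leRHS]Rintegral_unit_cst (le_trans (le_normr_Rintegral _ fi))//.
apply: le_Rintegral => //.
- apply: (@integrable_unit (fun y => `|f y|) M); first exact: measurableT_comp.
  by move=> y y01; rewrite normr_id fM.
- apply: (@integrable_unit (fun=> M) M) => // y y01.
  by rewrite ger0_norm// (le_trans _ (fM _ y01)).
Qed.

(** The bounds [M n] make the constant [limn (series M)] dominate every partial sum, so dominated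
    convergence applies on the unit interval. *)
Lemma cvg_series_Rintegral_unit (f : nat -> R -> R) F (M : R ^nat) :
  (forall n, measurable_fun I01 (f n)) ->
  (forall n y, 0 <= y <= 1 -> `|f n y| <= M n) ->
  cvgn (series M) ->
  (forall y, 0 <= y <= 1 -> series (f^~ y) @ \oo --> F y) ->
  series (fun n => \int[mu]_(y in I01) f n y) @ \oo -->
    \int[mu]_(y in I01) F y.
Proof.
move=> mf fM cM fF.
have series0 (u : R ^nat) : series u 0%N = 0 by rewrite /series/= big_geq.
have mS n : measurable_fun I01 (fun y => series (f^~ y) n).
  elim: n => [|n IHn].
    by rewrite (funext (fun y => series0 (f^~ y))); exact: measurable_cst.
  rewrite (funext (fun y => seriesSr (f^~ y) n)); exact: measurable_funD.
have M0 n : 0 <= M n.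
  by apply: (le_trans _ (fM n 0 _)) => //; rewrite lexx ler01.
have SM n y : 0 <= y <= 1 -> `|series (f^~ y) n| <= limn (series M).
  move=> y01; apply: (@le_trans _ _ (series M n)).
    rewrite /series/= (le_trans (ler_norm_sum _ _ _))//.
    by apply: ler_sum => i _; exact: fM.
  by apply: nondecreasing_cvgn_le => //; exact: nondecreasing_series.
have intS n : series (fun n => \int[mu]_(y in I01) f n y) n =
    \int[mu]_(y in I01) series (f^~ y) n.
  elim: n => [|n IHn].
    by under [RHS]eq_Rintegral do rewrite series0; rewrite Rintegral_unit_cst series0.
  under [RHS]eq_Rintegral do rewrite seriesSr.
  by rewrite seriesSr IHn RintegralD//; apply: integrable_unit; eauto.
have mF : measurable_fun I01 F.
  apply: (measurable_fun_cvg mS) => y /=; rewrite in_itv/=; exact: fF.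
have FM y : 0 <= y <= 1 -> `|F y| <= limn (series M).
  move=> y01; rewrite -(cvg_lim _ (cvg_norm (fF y y01)))//.
  apply: limr_le; first by apply/cvg_ex; eexists; exact: (cvg_norm (fF y y01)).
  by apply: nearW => n; exact: SM.
have : (\int[mu]_(y in I01) (series (f^~ y) n)%:E @[n --> \oo] -->
    \int[mu]_(y in I01) (F y)%:E)%E.
  apply: (@dominated_cvg _ _ _ mu I01 _ _ _ (fun=> (limn (series M))%:E)) => //.
  - by move=> n; apply/measurable_EFinP; exact: mS.
  - move=> y /=; rewrite in_itv/= => y01; apply: cvg_EFin; first exact: nearW.
    exact: fF.
  - apply: (@integrable_unit (fun=> _) (limn (series M))) => // y y01.
    by rewrite ger0_norm// (le_trans _ (SM 0 y y01)).
have -> : (\int[mu]_(y in I01) (F y)%:E = (\int[mu]_(y in I01) F y)%:E)%E.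
  by rewrite /Rintegral fineK//; apply: integrable_fin_num => //; exact: integrable_unit FM.
move=> /fine_cvg; rewrite (_ : fine \o _ = series (fun n => \int[mu]_(y in I01) f n y))//.
by apply/funext => n; exact/esym/intS.
Qed.

(** Derivatives are asked for in the open interval only, since the antiderivatives used below
    involve real powers of [y] that may not be differentiable at 0. *)
Lemma continuous_FTC2_unit f F : {within I01, continuous f} ->
  {within I01, continuous F} ->
  (forall y, 0 < y < 1 -> is_derive y 1 F (f y)) ->
  \int[mu]_(y in I01) f y = F 1 - F 0.
Proof.
move=> cf cF dF; rewrite /Rintegral (@continuous_FTC2 _ f F 0 1)//.
- have [_ F0 F1] := (continuous_within_itvP F (@ltr01 R)).1 cF.
  by split=> // y; rewrite in_itv/= => /dF [].
- by move=> y; rewrite in_itv/= => /dF [_ <-]; rewrite derive1E.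
Qed.

Lemma within_continuous_powR_unit p : 0 <= p ->
  {within I01, continuous (powR (R := R) ^~ p)}.
Proof.
(* The exponent 0 is separate: its power is 1 even at 0, whereas for a positive exponent the value
   at 0 is 0. *)
rewrite le_eqVlt => /predU1P[<-|p0].
  under [X in {within _, continuous X}]eq_fun do rewrite powRr0.
  exact: within_continuous_cst.
have cp y : 0 < y -> {for y, continuous (powR (R := R) ^~ p)}.
  move=> y0; apply: differentiable_continuous; apply/derivable1_diffP.
  by apply: derivable_powR; rewrite in_itv/= andbT.
apply/(continuous_within_itvP _ (@ltr01 R)); split.
- by move=> y; rewrite in_itv/= => /andP[y0 _]; exact: cp.
- by rewrite powR0 ?gt_eqF//; exact: powR_cvg0.
- by apply: cvg_at_left_filter; exact: cp.
Qed.

Lemma powR_unit p y : 0 <= p -> 0 <= y <= 1 -> 0 <= y `^ p <= 1.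
Proof.
move=> p0 /andP[y0 y1]; rewrite powR_ge0/=.
have -> : 1 = 1 `^ p by rewrite powR1.
by rewrite ge0_ler_powR ?nnegrE.
Qed.

End unit_interval_integral.

(** * Moments of the unit interval and two elementary integrals *)

Section moments.
Variable R : realType.
Local Notation mu := (@lebesgue_measure R).
Local Notation I01 := (`[0%R, 1%R]%classic : set R).
Implicit Types (m nu y z : R) (n : nat).

Lemma integrable_unit_continuous (f : R -> R) : {within I01, continuous f} ->
  mu.-integrable I01 (EFin \o f).
Proof. by apply: continuous_compact_integrable; exact: segment_compact. Qed.

Let within_continuous_onem_powR nu n : 0 <= nu ->
  {within I01, continuous (fun y => (1 - y `^ nu) ^+ n)}.
Proof.
move=> nu0; apply: (within_continuous_comp (g := fun x => (1 - x) ^+ n)).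
  by move=> y; exact: continuous_onemXn.
exact: within_continuous_powR_unit.
Qed.

Let moment m nu n : R := \int[mu]_(y in I01) (y `^ m * (1 - y `^ nu) ^+ n).

Lemma within_continuous_1DpowR s p : 0 <= s ->
  {within I01, continuous (fun y => (1 + y `^ s) `^ p)}.
Proof.
move=> s0; apply: (within_continuous_comp (f := fun y => 1 + y `^ s)
    (g := powR (R := R) ^~ p)) => [y|].
  have y0 : 0 < 1 + y `^ s by rewrite ltr_pwDl// powR_ge0.
  apply: differentiable_continuous; apply/derivable1_diffP.
  by apply: derivable_powR; rewrite in_itv/= andbT.
apply: within_continuousD; first exact: within_continuous_cst.
exact: within_continuous_powR_unit.
Qed.

Lemma Rintegral_unit_powR m : 0 <= m ->
  \int[mu]_(y in I01) y `^ m = (m + 1)^-1.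
Proof.
move=> m0; have m1 : m + 1 != 0 by rewrite gt_eqF// ltr_wpDl.
have := @continuous_FTC2_unit R (fun y => (m + 1) * y `^ m) (fun y => y `^ (m + 1)).
rewrite RintegralZl//; last first.
  by apply: integrable_unit_continuous; exact: within_continuous_powR_unit.
rewrite powR1 powR0// subr0 => FTC.
apply: (mulfI m1); rewrite divff//; apply: FTC.
- apply: within_continuousM; first exact: within_continuous_cst.
  exact: within_continuous_powR_unit.
- by apply: within_continuous_powR_unit; rewrite addr_ge0.
- move=> y /andP[y0 _]; have := is_derive1_powR (m + 1) y0; by rewrite addrK.
Qed.

(** [F] vanishes at both ends, so its derivative [f] has integral 0; [f] arises from the product
    rule by writing [X = 1 - (1 - X)] for [X] the power [nu] of [y]. *)
Let moment_rec m nu n : 0 <= m -> 0 < nu ->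
  (m + 1 + n.+1%:R * nu) * moment m nu n.+1 = n.+1%:R * nu * moment m nu n.
Proof.
move=> m0 nu0.
pose f y := (m + 1 + n.+1%:R * nu) * (y `^ m * (1 - y `^ nu) ^+ n.+1) -
            n.+1%:R * nu * (y `^ m * (1 - y `^ nu) ^+ n).
pose F y := y `^ (m + 1) * (1 - y `^ nu) ^+ n.+1.
have cmom k : {within I01, continuous (fun y => y `^ m * (1 - y `^ nu) ^+ k)}.
  apply: within_continuousM; first exact: within_continuous_powR_unit.
  exact/within_continuous_onem_powR/ltW.
have cZ c k : {within I01, continuous (fun y => c * (y `^ m * (1 - y `^ nu) ^+ k))}.
  by apply: within_continuousM; [exact: within_continuous_cst|exact: cmom].
have := @continuous_FTC2_unit R f F.
rewrite /F powR1 subrr expr0n/= mulr0 powR0 ?gt_eqF ?ltr_wpDl// mul0r subrr /f.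
rewrite RintegralB//; try exact: integrable_unit_continuous.
rewrite !RintegralZl//; try exact: integrable_unit_continuous.
rewrite -!/(moment _ _ _) => FTC; apply/eqP; rewrite -subr_eq0; apply/eqP; apply: FTC.
- rewrite (_ : (fun y => _) = fun y =>
    (m + 1 + n.+1%:R * nu) * (y `^ m * (1 - y `^ nu) ^+ n.+1) +
    (- (n.+1%:R * nu)) * (y `^ m * (1 - y `^ nu) ^+ n)).
    exact: within_continuousD.
  by apply/funext => y; rewrite mulNr.
- apply: within_continuousM; last exact/within_continuous_onem_powR/ltW.
  by apply: within_continuous_powR_unit; rewrite addr_ge0.
- move=> y /andP[y0 _].
  have dm := is_derive1_powR (m + 1) y0; rewrite addrK in dm.
  have dnu := is_derive1_powR nu y0.
  have dX : is_derive y 1 (fun y => (1 - y `^ nu) ^+ n.+1)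
      (n.+1%:R * (1 - y `^ nu) ^+ n * - (nu * y `^ (nu - 1))).
    have d1 : is_derive y 1 (fun y => 1 - y `^ nu) (- (nu * y `^ (nu - 1))).
      by apply: is_derive_eq; rewrite add0r mul1r.
    have := is_deriveX n.+1 d1; rewrite exprfctE.
    by apply.
  apply: is_derive_eq; rewrite /GRing.scale/=.
  have -> : y `^ (m + 1) = y `^ m * y.
    by rewrite powRD ?powRr1 ?(ltW y0)//; rewrite (gt_eqF y0) implybT.
  have -> : y `^ nu = y * y `^ (nu - 1) by rewrite mulr_powRB1// ltW.
  by rewrite exprS; ring.
Qed.

(** The Beta integral [B((m + 1) / nu, n + 1) / nu], obtained by induction from the recurrence
    without a change of variable. *)
Lemma momentE m nu n : 0 <= m -> 0 < nu ->
  \int[mu]_(y in I01) (y `^ m * (1 - y `^ nu) ^+ n) =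
  n`!%:R / ((m + 1) * rising (nu^-1 * (m + 1) + 1) n).
Proof.
move=> m0 nu0; rewrite -/(moment m nu n).
have m1 : 0 < m + 1 by rewrite ltr_wpDl.
elim: n => [|n IHn].
  rewrite /moment rising0 mulr1 div1r -Rintegral_unit_powR//.
  by apply: eq_Rintegral => y _; rewrite expr0 mulr1.
have c0 : 0 < m + 1 + n.+1%:R * nu by rewrite addr_gt0// mulr_gt0.
apply: (mulfI (lt0r_neq0 c0)); rewrite moment_rec// IHn risingS factS natrM.
have u0 : 0 < nu^-1 * (m + 1) + 1 by rewrite addr_gt0// mulr_gt0// invr_gt0.
have r0 := rising_gt0 n u0.
have -> : nu^-1 * (m + 1) + 1 + n%:R = (m + 1 + n.+1%:R * nu) / nu.
  by rewrite -natr1; field; rewrite gt_eqF.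
set c := m + 1 + _ in c0 *; set r := rising _ n in r0 *.
by field; rewrite !gt_eqF.
Qed.

Lemma Rintegral_unit_onem_powR nu : 0 < nu ->
  \int[mu]_(y in I01) (1 - y `^ nu) = (nu^-1 + 1)^-1.
Proof.
move=> nu0; have := momentE 1 (lexx 0) nu0.
under eq_Rintegral do rewrite powRr0 mul1r expr1.
by move=> ->; rewrite risingS rising0 addr0 add0r mulr1 !mul1r.
Qed.

(** The exponent [- (1 + s^-1)] is the one for which [y] times the power [- s^-1] of the base is an
    antiderivative: the product rule leaves the factor [(1 + Y) - Y = 1], with [Y] the power [s] of
    [y]. *)
Lemma Rintegral_unit_1DpowR s : 0 < s ->
  \int[mu]_(y in I01) (1 + y `^ s) `^ (- (1 + s^-1)) = 2 `^ (- s^-1).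
Proof.
move=> s0; have sn0 : s != 0 by rewrite gt_eqF.
have cont p : {within I01, continuous (fun y => (1 + y `^ s) `^ p)}.
  exact/within_continuous_1DpowR/ltW.
have := @continuous_FTC2_unit R _ (fun y => y * (1 + y `^ s) `^ (- s^-1)) (cont (- (1 + s^-1))).
rewrite powR1 mul1r mul0r subr0; apply=> //.
  by apply: within_continuousM => //; apply: continuous_subspaceT => y; exact: cvg_id.
move=> y /andP[y0 _].
have Y0 : 0 < 1 + y `^ s by rewrite addr_gt0// powR_gt0.
have dY : is_derive y 1 (fun y : R => 1 + y `^ s) (s * y `^ (s - 1)).
  have ds := is_derive1_powR s y0.
  by apply: is_derive_eq; rewrite add0r mul1r.
have dP : is_derive y 1 (fun y => (1 + y `^ s) `^ (- s^-1))
    (- s^-1 * (1 + y `^ s) `^ (- (1 + s^-1)) * (s * y `^ (s - 1))).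
  have dp := is_derive1_powR (- s^-1) Y0.
  rewrite (opprD 1) (addrC (-1)).
  exact: (@is_derive1_comp _ (fun z => z `^ (- s^-1)) (fun y => 1 + y `^ s) y _ _ dp dY).
apply: is_derive_eq; rewrite /GRing.scale/= mulr1.
have -> : (1 + y `^ s) `^ (- s^-1) = (1 + y `^ s) * (1 + y `^ s) `^ (- (1 + s^-1)).
  have -> : - s^-1 = 1 + - (1 + s^-1) by ring.
  by rewrite powRD ?powRr1 ?(ltW Y0)//; rewrite (gt_eqF Y0) implybT.
by rewrite -(mulr_powRB1 (ltW y0) s0); field.
Qed.

Lemma Rintegral_unit_1D s : 0 < s ->
  \int[mu]_(y in I01) (1 + y) `^ (- (1 + s^-1)) = s * (1 - 2 `^ (- s^-1)).
Proof.
move=> s0; have sn0 : s != 0 by rewrite gt_eqF.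
have cont p : {within I01, continuous (fun y => (1 + y) `^ p)}.
  (* The power 1 of [y] equals [y] only for [0 <= y], so the functions are identified on the
     interval. *)
  have := @within_continuous_1DpowR 1 p ler01.
  apply: subspace_eq_continuous => y; rewrite inE/= in_itv/= => /andP[y0 _].
  by rewrite -[LHS]/((1 + y `^ 1) `^ p) powRr1.
have := @continuous_FTC2_unit R _ (fun y => - s * (1 + y) `^ (- s^-1)) (cont (- (1 + s^-1))).
rewrite addr0 powR1 -[1 + 1]/2.
have -> : - s * 2 `^ (- s^-1) - - s * 1 = s * (1 - 2 `^ (- s^-1)) by ring.
apply.
- by apply: within_continuousM => //; exact: within_continuous_cst.
move=> y /andP[y0 _].
have Y0 : 0 < 1 + y by rewrite addr_gt0.
have dY : is_derive y 1 (fun y : R => 1 + y) 1.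
  by apply: is_derive_eq; rewrite add0r mul1r.
have dP : is_derive y 1 (fun y => (1 + y) `^ (- s^-1))
    (- s^-1 * (1 + y) `^ (- (1 + s^-1)) * 1).
  have dp := is_derive1_powR (- s^-1) Y0.
  rewrite (opprD 1) (addrC (-1)).
  exact: (@is_derive1_comp _ (fun z => z `^ (- s^-1)) (fun y => 1 + y) y _ _ dp dY).
by apply: is_derive_eq; rewrite /GRing.scale/=; field.
Qed.

End moments.

(** * The Abel sums as integrals *)

Section Abel_sum.
Variable R : realType.
Local Notation mu := (@lebesgue_measure R).
Local Notation I01 := (`[0%R, 1%R]%classic : set R).
Implicit Types (m nu tau al s y z eps : R) (n k : nat).

Lemma within_continuous_measurable_unit (f : R -> R) :
  {within I01, continuous f} -> measurable_fun I01 f.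
Proof. by apply: subspace_continuous_measurable_fun. Qed.

Let measurable_powR_unit p : measurable_fun I01 (fun y : R => y `^ p).
Proof. by apply: measurable_funTS; exact: measurable_powR. Qed.

Let root z nu y := Num.sqrt (1 - z * (1 - y `^ nu)).

Let within_continuous_root z nu : 0 <= nu -> {within I01, continuous (root z nu)}.
Proof.
move=> nu0; apply: (within_continuous_comp (f := fun y => 1 - z * (1 - y `^ nu))).
  by move=> y; exact: sqrt_continuous.
rewrite (_ : (fun y => _) = fun y => (1 - z) + z * y `^ nu); last first.
  by apply/funext => y; ring.
apply: within_continuousD; first exact: within_continuous_cst.
apply: within_continuousM; first exact: within_continuous_cst.
exact: within_continuous_powR_unit.
Qed.

(** A number [w] of the unit interval satisfies [w <= Num.sqrt w <= 1]. *)
Let root_bounds z nu y : 0 <= z <= 1 -> 0 <= nu -> 0 <= y <= 1 ->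
  1 - z * (1 - y `^ nu) <= root z nu y <= 1.
Proof.
move=> /andP[z0 z1] nu0 y01; have /andP[X0 X1] := powR_unit nu0 y01.
rewrite /root; set w := 1 - _.
have w0 : 0 <= w by rewrite /w; nra.
have w1 : w <= 1 by rewrite /w; nra.
have r0 := sqrtr_ge0 w; have := sqr_sqrtr w0.
have r1 : Num.sqrt w <= 1 by rewrite -[leRHS]sqrtr1 ler_wsqrtr.
by move=> rw; apply/andP; split=> //; nra.
Qed.

(** The square root is the binomial series with [q = - 2^-1]. Since the functions in [momentE] lie
    between 0 and 1, that series at [z < 1] dominates and can be integrated termwise; [n!] in the
    moment matches the parameter 1. *)
Lemma hypergeometric21E m nu z : 0 <= m -> 0 < nu -> 0 < z < 1 ->
  hypergeometric21 (- 2^-1) 1 (nu^-1 * (m + 1) + 1) z =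
  (m + 1) * \int[mu]_(y in I01) (y `^ m * Num.sqrt (1 - z * (1 - y `^ nu))).
Proof.
move=> m0 nu0 /andP[z0 z1].
rewrite -[\int[mu]_(y in I01) _]/(\int[mu]_(y in I01) (y `^ m * root z nu y)).
set c := nu^-1 * (m + 1) + 1.
have m1 : 0 < m + 1 by rewrite ltr_wpDl.
have c0 : 0 < c by rewrite addr_gt0// mulr_gt0// invr_gt0.
pose f n y := binomial_coeff (- 2^-1) n * z ^+ n * (y `^ m * (1 - y `^ nu) ^+ n).
have fmeas n : measurable_fun I01 (fun y => y `^ m * (1 - y `^ nu) ^+ n).
  apply: measurable_funM; first exact: measurable_powR_unit.
  by apply: measurable_funX; exact: measurable_funB.
have fb n y : 0 <= y <= 1 -> `|y `^ m * (1 - y `^ nu) ^+ n| <= 1.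
  move=> y01; have /andP[X0 X1] := powR_unit (ltW nu0) y01.
  have /andP[Y0 Y1] := powR_unit m0 y01.
  rewrite ger0_norm ?mulr_ge0 ?exprn_ge0 ?subr_ge0//.
  by rewrite mulr_ile1 ?exprn_ge0 ?exprn_ile1 ?subr_ge0// gerBl.
have zn1 : `|z| < 1 by rewrite gtr0_norm.
have cvgI : series (fun n => \int[mu]_(y in I01) f n y) @ \oo -->
    \int[mu]_(y in I01) (y `^ m * root z nu y).
  apply: (@cvg_series_Rintegral_unit R f _ (fun n => `|binomial_coeff (- 2^-1) n * z ^+ n|)).
  - by move=> n; apply: measurable_funM.
  - by move=> n y y01; rewrite /f normrM ler_piMr// fb.
  - exact: is_cvg_normed_binomial_series.
  - move=> y y01; have /andP[X0 X1] := powR_unit (ltW nu0) y01.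
    have zX : `|z * (1 - y `^ nu)| < 1.
      by rewrite ger0_norm ?mulr_ge0 ?subr_ge0 ?(ltW z0)//; nra.
    have -> : series (f^~ y) =
        y `^ m *: pseries (binomial_coeff (- 2^-1)) (z * (1 - y `^ nu)).
      rewrite /pseries -seriesZ; congr series; apply/funext => n.
      rewrite -[RHS]/(y `^ m * (binomial_coeff (- 2^-1) n * (z * (1 - y `^ nu)) ^+ n)).
      by rewrite /f exprMn; ring.
    apply: (cvgZl_tmp (k := y `^ m)).
    rewrite /root -powR12_sqrt ?subr_ge0 ?(le_trans (ler_norm _) (ltW zX))//.
    have := is_cvg_binomial_series (q := - 2^-1) zX.
    by rewrite /cvg_to/= binomial_series// opprK.
apply: cvg_lim => //.
rewrite (_ : series _ = (m + 1) *: series (fun n => \int[mu]_(y in I01) f n y)).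
  exact: cvgZl_tmp.
rewrite -seriesZ; congr series; apply/funext => n.
rewrite /GRing.scale/= /f RintegralZl//; last exact: integrable_unit (fb n).
have half i : - 2^-1 + i%:R != 0 :> R.
  case: i => [|i]; first by rewrite addr0 oppr_eq0 invr_eq0 pnatr_eq0.
  by rewrite gt_eqF// -[i.+1%:R]natr1; have := ler0n R i; lra.
have pos (x : R) i : 0 < x -> x + i%:R != 0 by move=> x0; rewrite gt_eqF// ltr_wpDr.
rewrite momentE// !pochhammerE//; try by move=> i; exact: pos.
rewrite rising1 /binomial_coeff -/c.
have r0 := rising_gt0 n c0.
have n0 : n`!%:R != 0 :> R by rewrite pnatr_eq0 -lt0n fact_gt0.
by rewrite /GRing.scale/=; field; rewrite n0 !gt_eqF.
Qed.

Let g z nu y := root z nu y + root (1 - z) nu y.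

(** In the sum of the two lower bounds the weights [z] and [1 - z] add up to 1, which removes [z]
    from the estimate. *)
Let g_bounds z nu y : 0 < z < 1 -> 0 <= nu -> 0 <= y <= 1 ->
  1 + y `^ nu <= g z nu y <= 2.
Proof.
move=> /andP[z0 z1] nu0 y01.
have /andP[l1 u1] : 1 - z * (1 - y `^ nu) <= root z nu y <= 1.
  by apply: root_bounds => //; rewrite !ltW.
have /andP[l2 u2] : 1 - (1 - z) * (1 - y `^ nu) <= root (1 - z) nu y <= 1.
  by apply: root_bounds => //; lra.
by rewrite /g; apply/andP; split; lra.
Qed.

Let g_norm_le2 z nu y : 0 < z < 1 -> 0 <= nu -> 0 <= y <= 1 -> `|g z nu y| <= 2.
Proof.
move=> z01 nu0 y01; have /andP[l u] := g_bounds z01 nu0 y01.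
by rewrite ger0_norm// (le_trans _ l)// addr_ge0// powR_ge0.
Qed.

Let measurable_g z nu : 0 <= nu -> measurable_fun I01 (g z nu).
Proof.
move=> nu0; apply: within_continuous_measurable_unit.
by apply: within_continuousD; exact: within_continuous_root.
Qed.

(** The closed form of the sum over [k], up to the factor [nu]. It is also evaluated at [eps = 1],
    where it gives the Abel limit. *)
Definition Abel_integral z nu tau al eps : R :=
  \int[mu]_(y in I01) ((1 + eps * y `^ tau) `^ (- al) *
    (Num.sqrt (1 - z * (1 - y `^ nu)) + Num.sqrt (1 - (1 - z) * (1 - y `^ nu)))).

Let Abel_integralE z nu tau al eps : Abel_integral z nu tau al eps =
  \int[mu]_(y in I01) ((1 + eps * y `^ tau) `^ (- al) * g z nu y).
Proof. by []. Qed.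

(** [hypergeometric21E] is used at [m = tau * k]: its factor [m + 1] cancels against [1 / u k] and
    leaves [nu]. The binomial series in [- eps] times the power [tau] of [y] is then summed under
    the integral. *)
Lemma cvg_perimeter_series (u : nat -> R) (a b : R) nu tau s eps :
  0 < a -> 0 < b -> 0 < nu -> 0 <= tau -> 0 < s -> 0 < eps < 1 ->
  (forall k, u k = nu^-1 * (tau * k%:R + 1)) ->
  series (perimeter_term u a b s eps) @ \oo -->
    nu * Abel_integral (b ^+ 2 / (a ^+ 2 + b ^+ 2)) nu tau (alpha s) eps.
Proof.
move=> a0 b0 nu0 tau0 s0 /andP[eps0 eps1] uE.
set z := b ^+ 2 / (a ^+ 2 + b ^+ 2).
have a2 : 0 < a ^+ 2 by rewrite exprn_gt0.
have b2 : 0 < b ^+ 2 by rewrite exprn_gt0.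
have ab2 : 0 < a ^+ 2 + b ^+ 2 by rewrite addr_gt0.
have z01 : 0 < z < 1 by rewrite divr_gt0//= ltr_pdivrMr// mul1r ltrDr.
have az : a ^+ 2 / (a ^+ 2 + b ^+ 2) = 1 - z by rewrite /z; field; rewrite gt_eqF.
have az01 : 0 < 1 - z < 1 by lra.
have al0 : 0 < alpha s by rewrite /alpha addr_gt0// invr_gt0.
pose f k y := binomial_coeff (alpha s) k * (- eps) ^+ k * ((y `^ tau) ^+ k * g z nu y).
have hm k : measurable_fun I01 (fun y => (y `^ tau) ^+ k * g z nu y).
  apply: measurable_funM; last by apply: measurable_g; exact: ltW.
  exact: measurable_funX (measurable_powR_unit tau).
have hb k y : 0 <= y <= 1 -> `|(y `^ tau) ^+ k * g z nu y| <= 2.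
  move=> y01; have /andP[Y0 Y1] := powR_unit tau0 y01.
  rewrite normrM ger0_norm ?exprn_ge0// -[leRHS]mul1r ler_pM ?exprn_ge0//.
    by rewrite exprn_ile1.
  by apply: g_norm_le2 => //; exact: ltW.
have eps1n : `|- eps| < 1 by rewrite normrN gtr0_norm.
have termE k : perimeter_term u a b s eps k = nu * \int[mu]_(y in I01) f k y.
  have m0 : 0 <= tau * k%:R by rewrite mulr_ge0.
  have m1 : 0 < tau * k%:R + 1 by rewrite ltr_wpDl.
  rewrite /f RintegralZl//; last exact: integrable_unit (hb k).
  rewrite /perimeter_term az -/z uE !hypergeometric21E// -mulrDr.
  rewrite pochhammerE; last by move=> i; rewrite gt_eqF// ltr_wpDr.
  rewrite -RintegralD//; last 2 first.
  - apply: integrable_unit_continuous; apply: within_continuousM.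
      exact: within_continuous_powR_unit.
    exact/within_continuous_root/ltW.
  - apply: integrable_unit_continuous; apply: within_continuousM.
      exact: within_continuous_powR_unit.
    exact/within_continuous_root/ltW.
  have -> : \int[mu]_(y in I01) (y `^ (tau * k%:R) * Num.sqrt (1 - z * (1 - y `^ nu)) +
      y `^ (tau * k%:R) * Num.sqrt (1 - (1 - z) * (1 - y `^ nu))) =
      \int[mu]_(y in I01) ((y `^ tau) ^+ k * g z nu y).
    apply: eq_Rintegral => y _.
    by rewrite -mulrDr powRrM powR_mulrn// powR_ge0.
  rewrite /binomial_coeff.
  have n0 : k`!%:R != 0 :> R by rewrite pnatr_eq0 -lt0n fact_gt0.
  by field; rewrite n0 !gt_eqF.
have -> : perimeter_term u a b s eps = nu *: (fun k => \int[mu]_(y in I01) f k y).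
  by apply/funext => k; rewrite termE.
rewrite seriesZ; apply: (cvgZl_tmp (k := nu)).
rewrite Abel_integralE.
apply: (@cvg_series_Rintegral_unit R f _
  (2 *: (fun k => `|binomial_coeff (alpha s) k * (- eps) ^+ k|))).
- by move=> k; apply: measurable_funM.
- by move=> k y y01; rewrite /f normrM mulrC ler_wpM2r// hb.
- by apply: is_cvg_seriesZ; exact: is_cvg_normed_binomial_series.
- move=> y y01; have /andP[Y0 Y1] := powR_unit tau0 y01.
  have eY : `|- eps * y `^ tau| < 1.
    by rewrite normrM normrN (gtr0_norm eps0) (ger0_norm Y0); nra.
  have -> : series (f^~ y) =
      g z nu y *: pseries (binomial_coeff (alpha s)) (- eps * y `^ tau).
    rewrite /pseries -seriesZ; congr series; apply/funext => k.
    rewrite -[RHS]/(g z nu y * (binomial_coeff (alpha s) k * (- eps * y `^ tau) ^+ k)).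
    by rewrite /f exprMn; ring.
  rewrite [X in _ --> X]mulrC; apply: (cvgZl_tmp (k := g z nu y)).
  have := is_cvg_binomial_series (q := alpha s) eY.
  by rewrite /cvg_to/= binomial_series// mulNr opprK.
Qed.

Let Abel_kernel_bounds tau al eps y : 0 <= tau -> 0 <= al -> 0 < eps <= 1 ->
  0 <= y <= 1 ->
  0 <= (1 + eps * y `^ tau) `^ (- al) <= 1.
Proof.
move=> tau0 al0 /andP[eps0 eps1] /(powR_unit tau0)/andP[Y0 Y1].
have eY : 0 <= eps * y `^ tau by rewrite mulr_ge0// ltW.
rewrite powR_ge0/= powRN invf_le1 ?powR_gt0 ?ltr_pwDl//.
have {1}-> : 1 = 1 `^ al by rewrite powR1.
by rewrite ge0_ler_powR ?nnegrE ?addr_ge0// lerDl.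
Qed.

(** The upper bound rests on [(1 + Y) * (1 + eps) <= 2 * (1 + eps * Y)], whose two sides differ by
    [(1 - eps) * (1 - Y)]. The comparison factor does not depend on [y]. *)
Let Abel_kernel_compare tau al eps y : 0 <= tau -> 0 <= al -> 0 < eps <= 1 ->
  0 <= y <= 1 ->
  (1 + 1 * y `^ tau) `^ (- al) <= (1 + eps * y `^ tau) `^ (- al) <=
    (2 / (1 + eps)) `^ al * (1 + 1 * y `^ tau) `^ (- al).
Proof.
move=> tau0 al0 /andP[eps0 eps1] /(powR_unit tau0)/andP[Y0 Y1].
set Y := y `^ tau in Y0 Y1 *.
have eY : 0 <= eps * Y by rewrite mulr_ge0// ltW.
have A0 : 0 < 1 + eps * Y by rewrite ltr_pwDl.
have B0 : 0 < 1 + 1 * Y by rewrite mul1r ltr_pwDl.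
have C0 : 0 <= 2 / (1 + eps) by rewrite divr_ge0// addr_ge0// ltW.
rewrite !powRN lef_pV2 ?posrE ?powR_gt0//; apply/andP; split.
  apply: ge0_ler_powR => //; rewrite ?nnegrE ?(ltW A0) ?(ltW B0)//; nra.
rewrite ler_pdivlMr ?powR_gt0// mulrC ler_pdivrMr ?powR_gt0//.
rewrite -powRM ?(ltW A0)//; apply: ge0_ler_powR => //.
- by rewrite nnegrE ltW.
- by rewrite nnegrE mulr_ge0// ltW.
rewrite mulrAC ler_pdivlMr ?addr_gt0//; nra.
Qed.

Let measurable_kernel tau al eps :
  measurable_fun I01 (fun y => (1 + eps * y `^ tau) `^ (- al)).
Proof.
have mk : measurable_fun I01 (fun y => 1 + eps * y `^ tau).
  apply: measurable_funD => //.
  exact: measurable_funM (measurable_cst _) (measurable_powR_unit tau).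
exact: (measurableT_comp (@measurable_powR R (- al)) mk).
Qed.

Let measurable_integrand z nu tau al eps : 0 <= nu ->
  measurable_fun I01 (fun y => (1 + eps * y `^ tau) `^ (- al) * g z nu y).
Proof.
by move=> nu0; apply: measurable_funM; [exact: measurable_kernel|exact: measurable_g].
Qed.

Let integrand_le2 z nu tau al eps y : 0 < z < 1 -> 0 <= nu -> 0 <= tau ->
  0 <= al -> 0 < eps <= 1 -> 0 <= y <= 1 ->
  `|(1 + eps * y `^ tau) `^ (- al) * g z nu y| <= 2.
Proof.
move=> z01 nu0 tau0 al0 eps01 y01.
have /andP[K0 K1] := Abel_kernel_bounds tau0 al0 eps01 y01.
by rewrite normrM (ger0_norm K0) -[leRHS]mul1r ler_pM ?g_norm_le2.
Qed.

Let integrable_integrand z nu tau al eps : 0 < z < 1 -> 0 <= nu -> 0 <= tau ->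
  0 <= al -> 0 < eps <= 1 ->
  mu.-integrable I01 (EFin \o (fun y => (1 + eps * y `^ tau) `^ (- al) * g z nu y)).
Proof.
move=> z01 nu0 tau0 al0 eps01; apply: integrable_unit; first exact: measurable_integrand.
by move=> y; exact: integrand_le2.
Qed.

Lemma cvg_Abel_integral z nu tau al : 0 < z < 1 -> 0 <= nu -> 0 <= tau -> 0 <= al ->
  Abel_integral z nu tau al eps @[eps --> 1^'-] --> Abel_integral z nu tau al 1.
Proof.
move=> z01 nu0 tau0 al0.
(* An explicit uniform error: the kernels differ by at most the comparison factor minus 1, since the
   kernel at 1 is at most 1, and [|g| <= 2]. *)
pose h (eps : R) := 2 * ((2 / (1 + eps)) `^ al - 1).
have dist eps : 0 < eps <= 1 ->
    `|Abel_integral z nu tau al eps - Abel_integral z nu tau al 1| <= h eps.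
  move=> eps01; have one01 : 0 < (1 : R) <= 1 by rewrite ltr01 lexx.
  rewrite !Abel_integralE -RintegralB//; try exact: integrable_integrand.
  apply: normr_Rintegral_unit_le.
    by apply: measurable_funB; exact: measurable_integrand.
  move=> y y01; rewrite -mulrBl normrM mulrC /h ler_pM ?g_norm_le2//.
  have /andP[AB BA] := Abel_kernel_compare tau0 al0 eps01 y01.
  have /andP[B0 B1] := Abel_kernel_bounds tau0 al0 one01 y01.
  have C1 : 1 <= (2 / (1 + eps)) `^ al.
    have {1}-> : 1 = 1 `^ al by rewrite powR1.
    move: eps01 => /andP[e0 e1]; have e2 : 0 < 1 + eps by rewrite addr_gt0.
    rewrite ge0_ler_powR ?nnegrE ?divr_ge0 ?(ltW e2)//.
    by rewrite ler_pdivlMr//; lra.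
  by rewrite ger0_norm ?subr_ge0//; nra.
have h0 : h eps @[eps --> 1^'-] --> (0 : R).
  have -> : 0 = 2 * (1 `^ al - 1) :> R by rewrite powR1 subrr mulr0.
  apply: cvgMl_tmp; apply: cvgB; last exact: cvg_cst.
  have quo : 2 / (1 + eps) @[eps --> 1^'-] --> (1 : R).
    rewrite [X in _ --> X](_ : 1 = 2 / (1 + 1)); last first.
      by rewrite divff// -[1 + 1]/(2%:R) pnatr_eq0.
    apply: cvg_at_left_filter; apply: cvgMl_tmp; apply: cvgV.
      by rewrite -[1 + 1]/(2%:R) pnatr_eq0.
    by apply: cvgD; [exact: cvg_cst|exact: cvg_id].
  have pow : {for (1 : R), continuous (fun x => x `^ al)}.
    apply: differentiable_continuous; apply/derivable1_diffP.
    by apply: derivable_powR; rewrite in_itv/= andbT.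
  exact: (cvg_comp _ _ quo pow).
set L := Abel_integral z nu tau al 1 in dist *.
apply: (@squeeze_cvgr _ _ _ _ (fun eps => L - h eps) (fun eps => L + h eps)).
- near=> eps.
  have /dist : 0 < eps <= 1.
    by apply/andP; split; near: eps; [exact: nbhs_left_gt|exact: nbhs_left_le].
  by rewrite ler_distl.
- by rewrite -[X in _ --> X]subr0; apply: cvgB => //; exact: cvg_cst.
- by rewrite -[X in _ --> X]addr0; apply: cvgD => //; exact: cvg_cst.
Unshelve. all: by end_near. Qed.

(** [g_bounds] places [g] within [1 - X] of 2, with [X] the power [nu] of [y], and the kernel is at
    most 1; the right-hand side is the integral of [1 - X]. *)
Lemma Abel_integral_approx z nu tau al : 0 < z < 1 -> 0 < nu -> 0 <= tau -> 0 <= al ->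
  `|Abel_integral z nu tau al 1 -
    2 * \int[mu]_(y in I01) (1 + y `^ tau) `^ (- al)| <= (nu^-1 + 1)^-1.
Proof.
move=> z01 nu0 tau0 al0; have one01 : 0 < (1 : R) <= 1 by rewrite ltr01 lexx.
pose K y := (1 + 1 * y `^ tau) `^ (- al).
have Kb y : 0 <= y <= 1 -> 0 <= K y <= 1.
  by move=> y01; exact: Abel_kernel_bounds.
have mK : measurable_fun I01 K by exact: measurable_kernel.
have iK : mu.-integrable I01 (EFin \o K).
  apply: (@integrable_unit _ _ 1 mK) => y /Kb /andP[K0 K1].
  by rewrite ger0_norm.
have -> : \int[mu]_(y in I01) (1 + y `^ tau) `^ (- al) = \int[mu]_(y in I01) K y.
  by apply: eq_Rintegral => y _; rewrite /K mul1r.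
rewrite -RintegralZl// Abel_integralE -RintegralB//; last 2 first.
- by apply: integrable_integrand => //; exact: ltW.
- apply: (@integrable_unit _ _ 2) => [|y /Kb /andP[K0 K1]].
    exact: measurable_funM (measurable_cst _) mK.
  by rewrite ger0_norm ?mulr_ge0// ler_piMr.
have mX : measurable_fun I01 (fun y : R => 1 - y `^ nu).
  exact: measurable_funB (measurable_cst _) (measurable_powR_unit nu).
have bound y : 0 <= y <= 1 -> `|K y * g z nu y - 2 * K y| <= 1 - y `^ nu.
  move=> y01; have /andP[K0 K1] := Kb y y01.
  have /andP[X0 X1] := powR_unit (ltW nu0) y01.
  have /andP[l u] := g_bounds z01 (ltW nu0) y01.
  by rewrite ler_norml; apply/andP; split; nra.
have iX : mu.-integrable I01 (EFin \o (fun y : R => 1 - y `^ nu)).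
  apply: (@integrable_unit _ _ 1 mX) => y /(powR_unit (ltW nu0))/andP[X0 X1].
  by rewrite ger0_norm ?subr_ge0// gerBl.
have mD : measurable_fun I01 (fun y => K y * g z nu y - 2 * K y).
  apply: measurable_funB; first by apply: measurable_integrand; exact: ltW.
  exact: measurable_funM (measurable_cst _) mK.
have D1 y : 0 <= y <= 1 -> `|K y * g z nu y - 2 * K y| <= 1.
  move=> y01; rewrite (le_trans (bound _ y01))// gerBl.
  by have /andP[] := powR_unit (ltW nu0) y01.
rewrite -Rintegral_unit_onem_powR// (le_trans (le_normr_Rintegral _ (integrable_unit mD D1)))//.
apply: le_Rintegral => //.
apply: (@integrable_unit _ (fun y => `|K y * g z nu y - 2 * K y|) 1).
  exact: measurableT_comp.
by move=> y y01; rewrite normr_id D1.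
Qed.

End Abel_sum.

(** * The limits of the two branches *)

Section branches.
Variables (R : realType) (a b : R).
Hypotheses (a0 : 0 < a) (b0 : 0 < b).
Implicit Types s eps : R.

Let c := Num.sqrt (a ^+ 2 + b ^+ 2).
Let z := b ^+ 2 / (a ^+ 2 + b ^+ 2).

Let z01 : 0 < z < 1.
Proof.
have a2 : 0 < a ^+ 2 by rewrite exprn_gt0.
have b2 : 0 < b ^+ 2 by rewrite exprn_gt0.
by rewrite divr_gt0 ?addr_gt0//= ltr_pdivrMr ?addr_gt0// mul1r ltrDr.
Qed.

Let alpha_ge0 s : 0 < s -> 0 <= alpha s.
Proof. by move=> s0; rewrite addr_ge0// invr_ge0 ltW. Qed.

Let u_plusE s k : 1 < s -> u_plus s k = (2 * (s - 1))^-1 * (s * k%:R + 1).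
Proof. by move=> s1; rewrite /u_plus mulrC. Qed.

Let u_minusE s k : 0 < s < 1 ->
  u_minus s k = (2 * (1 - s) / s)^-1 * (1 * k%:R + 1).
Proof.
by move=> /andP[s0 s1]; rewrite /u_minus mul1r; field; rewrite gt_eqF//= subr_eq0 gt_eqF.
Qed.

Let Aplus s eps := Abel_integral z (2 * (s - 1)) s (alpha s) eps.
Let Aminus s eps := Abel_integral z (2 * (1 - s) / s) 1 (alpha s) eps.

Let cvg_plus s eps : 1 < s -> 0 < eps < 1 ->
  series (perimeter_term (u_plus s) a b s eps) @ \oo --> 2 * (s - 1) * Aplus s eps.
Proof.
move=> s1 eps01; have s0 : 0 < s by exact: lt_trans s1.
apply: cvg_perimeter_series => //; first by rewrite mulr_gt0// subr_gt0.
- exact: ltW.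
- by move=> k; exact: u_plusE.
Qed.

Let cvg_minus s eps : 0 < s < 1 -> 0 < eps < 1 ->
  series (perimeter_term (u_minus s) a b s eps) @ \oo -->
    2 * (1 - s) / s * Aminus s eps.
Proof.
move=> s01 eps01; have /andP[s0 s1] := s01.
apply: cvg_perimeter_series => //.
- by rewrite divr_gt0// mulr_gt0// subr_gt0.
- by move=> k; exact: u_minusE.
Qed.

Lemma is_cvg_series_plus s eps : 1 < s -> 0 < eps < 1 ->
  cvgn (series (perimeter_term (u_plus s) a b s eps)).
Proof. by move=> s1 eps01; apply: cvgP (cvg_plus s1 eps01). Qed.

Lemma is_cvg_series_minus s eps : 0 < s < 1 -> 0 < eps < 1 ->
  cvgn (series (perimeter_term (u_minus s) a b s eps)).
Proof. by move=> s01 eps01; apply: cvgP (cvg_minus s01 eps01). Qed.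

Let near_left1 : \forall eps \near (1 : R)^'-, 0 < eps < 1.
Proof.
near=> eps; apply/andP; split; near: eps; [exact: nbhs_left_gt|exact: nbhs_left_lt].
Unshelve. all: by end_near. Qed.

(** The prefactor has a pole at [s = 1], which the factor [nu = 2 * (s - 1)] of the summed series
    cancels. *)
Let cvg_L_plus s : 1 < s ->
  L_plus a b s eps @[eps --> 1^'-] --> 4 * c * Aplus s 1.
Proof.
move=> s1; have s0 : 0 < s by exact: lt_trans s1.
apply: (@cvg_trans _ (4 * c * Aplus s eps @[eps --> 1^'-])).
  apply: near_eq_cvg; apply: filterS near_left1 => eps eps01.
  rewrite /L_plus (cvg_lim _ (cvg_plus s1 eps01))// -/c; field.
  by rewrite subr_eq0 gt_eqF.
apply: cvgMl_tmp; apply: cvg_Abel_integral => //; try exact: ltW; last exact: alpha_ge0.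
by rewrite mulr_ge0// subr_ge0 ltW.
Qed.

Let cvg_L_minus s : 0 < s < 1 ->
  L_minus a b s eps @[eps --> 1^'-] --> 4 * c / s * Aminus s 1.
Proof.
move=> s01; have /andP[s0 s1] := s01.
apply: (@cvg_trans _ (4 * c / s * Aminus s eps @[eps --> 1^'-])).
  apply: near_eq_cvg; apply: filterS near_left1 => eps eps01.
  rewrite /L_minus (cvg_lim _ (cvg_minus s01 eps01))// -/c; field.
  by rewrite (gt_eqF s0) subr_eq0 (lt_eqF s1).
apply: cvgMl_tmp; apply: cvg_Abel_integral => //; last exact: alpha_ge0.
by rewrite divr_ge0 ?(ltW s0)// mulr_ge0// subr_ge0 ltW.
Qed.

Lemma is_cvg_L_plus s : 1 < s -> cvg (L_plus a b s eps @[eps --> 1^'-]).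
Proof. by move=> s1; apply: cvgP (cvg_L_plus s1). Qed.

Lemma is_cvg_L_minus s : 0 < s < 1 -> cvg (L_minus a b s eps @[eps --> 1^'-]).
Proof. by move=> s01; apply: cvgP (cvg_L_minus s01). Qed.

Let invD1_le nu : 0 < nu -> (nu^-1 + 1)^-1 <= nu :> R.
Proof.
move=> nu0; have nuV : 0 < nu^-1 by rewrite invr_gt0.
by rewrite -[leRHS]invrK lef_pV2 ?posrE ?addr_gt0// lerDl.
Qed.

Let Aplus_approx s : 1 < s ->
  `|Aplus s 1 - 2 * 2 `^ (- s^-1)| <= 2 * (s - 1).
Proof.
move=> s1; have s0 : 0 < s by exact: lt_trans s1.
have nu0 : 0 < 2 * (s - 1) by rewrite mulr_gt0// subr_gt0.
apply: le_trans (invD1_le nu0).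
rewrite -Rintegral_unit_1DpowR// -/(alpha s).
by apply: Abel_integral_approx => //; [exact: ltW|exact: alpha_ge0].
Qed.

Let Aminus_approx s : 0 < s < 1 ->
  `|Aminus s 1 - 2 * (s * (1 - 2 `^ (- s^-1)))| <= 2 * (1 - s) / s.
Proof.
move=> /andP[s0 s1].
have nu0 : 0 < 2 * (1 - s) / s by rewrite divr_gt0// mulr_gt0// subr_gt0.
apply: le_trans (invD1_le nu0).
rewrite -Rintegral_unit_1D// -/(alpha s).
have -> : \int[lebesgue_measure]_(y in (`[0%R, 1%R]%classic : set R)) (1 + y) `^ (- alpha s) =
    \int[lebesgue_measure]_(y in (`[0%R, 1%R]%classic : set R)) (1 + y `^ 1) `^ (- alpha s).
  apply: eq_Rintegral => y.
  by rewrite inE/= in_itv/= => /andP[y0 _]; rewrite powRr1.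
by apply: Abel_integral_approx => //; exact: alpha_ge0.
Qed.

(** Stated for any filter tending to 1, so that it serves both one-sided limits; the exponential
    form gives continuity in the exponent. *)
Let cvg_pow2 (F : set_system R) : Filter F -> F --> (1 : R) ->
  (2 : R) `^ (- s^-1) @[s --> F] --> (2^-1 : R).
Proof.
move=> FF F1.
have -> : (fun s => 2 `^ (- s^-1)) = (fun s => expR (- s^-1 * ln 2)) :> (R -> R).
  by apply/funext => s; rewrite /powR pnatr_eq0.
have -> : 2^-1 = expR (- 1^-1 * ln 2) :> R.
  by rewrite invr1 mulN1r expRN lnK// posrE.
apply: (@cvg_comp _ _ _ (fun s : R => - s^-1 * ln 2) expR _ (nbhs (- 1^-1 * ln 2 : R))).
  apply: cvgMr_tmp; apply: cvgN; apply: cvgV => //; exact: oner_neq0.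
exact: continuous_expR.
Qed.

Let cvg_approx (F : set_system R) (f m e : R -> R) (l : R) : ProperFilter F ->
  (\forall s \near F, `|f s - m s| <= e s) ->
  m s @[s --> F] --> l -> e s @[s --> F] --> 0 -> f s @[s --> F] --> l.
Proof.
move=> FF fme ml e0; apply: (@squeeze_cvgr _ _ _ _ (fun s => m s - e s) (fun s => m s + e s)).
- by apply: filterS fme => s; rewrite ler_distl.
- by rewrite -[l]subr0; exact: cvgB.
- by rewrite -[l]addr0; exact: cvgD.
Qed.

(** For [s] to the right of 1 the inner limit is [4 * c * Aplus s 1], and [Aplus s 1] tends to
    [2 * 2^-1 = 1]. *)
Lemma cvg_lim_L_plus :
  lim (L_plus a b s eps @[eps --> 1^'-]) @[s --> 1^'+] --> 4 * c.
Proof.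
have id1 : (fun s => s) @ (1 : R)^'+ --> (1 : R).
  by apply: cvg_at_right_filter; exact: cvg_id.
suff key : 4 * c * Aplus s 1 @[s --> 1^'+] --> 4 * c.
  apply: cvg_trans key; apply: near_eq_cvg; near=> s.
  apply/esym/cvg_lim => //; apply: cvg_L_plus.
  by near: s; exact: nbhs_right_gt.
rewrite -[X in _ --> X]mulr1; apply: cvgMl_tmp.
apply: (cvg_approx (m := fun s => 2 * 2 `^ (- s^-1)) (e := fun s => 2 * (s - 1))).
- near=> s; apply: Aplus_approx; near: s; exact: nbhs_right_gt.
- rewrite -[X in _ --> X](divff (_ : 2 != 0)) ?pnatr_eq0//.
  by apply: cvgMl_tmp; exact: cvg_pow2.
- rewrite -[X in _ --> X](mulr0 2) -(subrr 1).
  by apply: cvgMl_tmp; apply: cvgB => //; exact: cvg_cst.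
Unshelve. all: by end_near. Qed.

(** The same value comes from another integral: [Aminus s 1] tends to [2 * (1 * (1 - 2^-1)) = 1],
    and the additional factor [s^-1] tends to 1. *)
Lemma cvg_lim_L_minus :
  lim (L_minus a b s eps @[eps --> 1^'-]) @[s --> 1^'-] --> 4 * c.
Proof.
have id1 : (fun s => s) @ (1 : R)^'- --> (1 : R).
  by apply: cvg_at_left_filter; exact: cvg_id.
suff key : 4 * c / s * Aminus s 1 @[s --> 1^'-] --> 4 * c.
  apply: cvg_trans key; apply: near_eq_cvg; apply: filterS near_left1 => s s01.
  by apply/esym/cvg_lim => //; exact: cvg_L_minus.
have V1 : s^-1 @[s --> (1 : R)^'-] --> (1 : R).
  by rewrite -[X in _ --> X]invr1; apply: cvgV => //; exact: oner_neq0.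
rewrite -[X in _ --> X]mulr1; apply: cvgM.
  by rewrite -[X in _ --> X]mulr1; exact: cvgMl_tmp.
apply: (cvg_approx (m := fun s => 2 * (s * (1 - 2 `^ (- s^-1))))
                   (e := fun s => 2 * (1 - s) / s)).
- by apply: filterS near_left1 => s; exact: Aminus_approx.
- rewrite [X in _ --> X](_ : 1 = 2 * (1 * (1 - 2^-1))); last by field.
  apply: cvgMl_tmp; apply: cvgM => //.
  by apply: cvgB; [exact: cvg_cst|exact: cvg_pow2].
- rewrite [X in _ --> X](_ : 0 = 2 * (1 - 1) * 1); last by ring.
  apply: cvgM => //; apply: cvgMl_tmp.
  by apply: cvgB => //; exact: cvg_cst.
Unshelve. all: by end_near. Qed.

End branches.

(** The convergence clauses accompany the limits because [limn] and [lim] denote genuine limits only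
    under convergence. *)
Theorem corollary5p3 (R : realType) (a b : R) (ha : 0 < a) (hb : 0 < b) :
  [/\ superellipse_perimeter 1 a b = (4 * Num.sqrt (a ^+ 2 + b ^+ 2))%:E,
      [/\ (forall s eps : R, 1 < s -> 0 < eps < 1 ->
             cvgn (series (perimeter_term (u_plus s) a b s eps))),
          (forall s : R, 1 < s -> cvg (L_plus a b s eps @[eps --> 1^'-])) &
          lim (L_plus a b s eps @[eps --> 1^'-]) @[s --> 1^'+]
            --> 4 * Num.sqrt (a ^+ 2 + b ^+ 2)] &
      [/\ (forall s eps : R, 0 < s < 1 -> 0 < eps < 1 ->
             cvgn (series (perimeter_term (u_minus s) a b s eps))),
          (forall s : R, 0 < s < 1 ->
             cvg (L_minus a b s eps @[eps --> 1^'-])) &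
          lim (L_minus a b s eps @[eps --> 1^'-]) @[s --> 1^'-]
            --> 4 * Num.sqrt (a ^+ 2 + b ^+ 2)]].
Proof.
split; first exact: superellipse_perimeter1.
- split=> [s eps|s|]; first exact: is_cvg_series_plus.
  + exact: is_cvg_L_plus.
  + exact: cvg_lim_L_plus.
- split=> [s eps|s|]; first exact: is_cvg_series_minus.
  + exact: is_cvg_L_minus.
  + exact: cvg_lim_L_minus.
Qed.
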